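(* Let $p\in[1,+\infty]$ with conjugate exponent $q$, let $(\Omega,\mathcal A,\mathbb P)$ be a nonatomic probability space, and let $\rho:\mathbb L^p(\Omega,\mathbb R)\to\mathbb R$ be a law-invariant coherent risk measure, which is assumed to satisfy the Fatou property if $p=+\infty$. Then there exists a subset $R\subset\mathcal P_q(\mathbb R)$ with $\sup_{r\in R}\mathcal M_q(r)<+\infty$, and such that $\mathrm{supp}(r)\subset\mathbb R_+$ and $\int_{\mathbb R}y\,\mathrm dr(y)=1$ for every $r\in R$, for which $$\rho(X)=\chi_R(\mathbb P_X)\qquad\text{for each }X\in\mathbb L^p(\Omega,\mathbb R).$$
   Context: The conjugate exponent $q$ of $p$ satisfies $1/p+1/q=1$ ($q=+\infty$ if $p=1$, $q=1$ if $p=+\infty$), and $\mathbb R_+=[0,+\infty)$. For a Borel probability measure $m$ on $\mathbb R$, $\mathcal M_s(m)=\big(\int|x|^s\,\mathrm dm(x)\big)^{1/s}$ if $s<+\infty$ and $\mathcal M_\infty(m)=\sup_{x\in\mathrm{supp}(m)}|x|$; $\mathcal P_s(\mathbb R)$ is the set of Borel probability measures on $\mathbb R$ with $\mathcal M_s(m)<+\infty$. $\mathbb P_X$ denotes the law of a random variable $X$. For $m\in\mathcal P_p(\mathbb R)$, $\Pi(m,R)$ is the set of Borel probability measures $\pi$ on $\mathbb R^2$ whose first marginal is $m$ and whose second marginal belongs to $R$, and $\chi_R(m)=\sup_{\pi\in\Pi(m,R)}\int_{\mathbb R^2}xy\,\mathrm d\pi(x,y)$. A risk measure is a real-valued map $\rho:\mathbb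 L^p(\Omega,\mathbb R)\to\mathbb R$. It is coherent if for all $X_1,X_2,X\in\mathbb L^p(\Omega,\mathbb R)$, $\alpha\in\mathbb R$, $\delta\ge0$, $\theta\in[0,1]$: (i) $\rho(X+\alpha)=\rho(X)+\alpha$; (ii) $\rho(\delta X)=\delta\rho(X)$; (iii) $\rho(X_1)\le\rho(X_2)$ whenever $X_1\le X_2$ almost surely; (iv) $\rho((1-\theta)X_1+\theta X_2)\le(1-\theta)\rho(X_1)+\theta\rho(X_2)$. It is law-invariant if $\rho(X_1)=\rho(X_2)$ whenever $\mathbb P_{X_1}=\mathbb P_{X_2}$. A risk measure $\rho:\mathbb L^\infty(\Omega,\mathbb R)\to\mathbb R$ satisfies the Fatou property if for any bounded sequence $(X_n)$ in $\mathbb L^\infty(\Omega,\mathbb R)$ converging in probability to $X\in\mathbb L^\infty(\Omega,\mathbb R)$ one has $\rho(X)\le\liminf_{n\to+\infty}\rho(X_n)$. *)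

(* Defs.v *)
From HB Require Import structures.
From mathcomp Require Import all_boot all_order all_algebra.
From mathcomp Require Import all_classical all_reals all_analysis.
From mathcomp Require Import ess_sup_inf.

Set Implicit Arguments.
Unset Strict Implicit.
Unset Printing Implicit Defensive.

Import Order.TTheory GRing.Theory Num.Theory.
Import numFieldNormedType.Exports.

Local Open Scope classical_set_scope.
Local Open Scope ring_scope.

(* A library measure is a function on all subsets, with unspecified values
   outside the sigma-algebra: equality of measures is therefore equality on
   measurable sets, not Leibniz equality. *)
Definition same_measure (d : measure_display) (T : measurableType d)
    (R : realType) (m1 m2 : set T -> \bar R) : Prop :=
  forall A : set T, measurable A -> m1 A = m2 A.

Definition measure_supp (R : realType) (m : probability R R) : set R :=
  [set x | forall U : set R, open U -> U x -> (0 < m U)%E].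

(* For finite s, 'N[m]_s[EFin] unfolds to (\int[m]_x `|x|^s)^(1/s). *)
Definition moment (R : realType) (s : \bar R) (m : probability R R) : \bar R :=
  if s == +oo%E then ereal_sup [set `|x|%:E | x in measure_supp m]
  else ('N[m]_s[EFin])%E.

Definition finite_moment (R : realType) (s : \bar R) : set (probability R R) :=
  [set m | (moment s m < +oo)%E].

Definition couplings (R : realType) (m : probability R R)
    (D : set (probability R R)) : set (probability (R * R)%type R) :=
  [set nu : probability (R * R)%type R |
     same_measure (pushforward nu fst) m /\
     exists2 r, D r & same_measure (pushforward nu snd) r].

Definition chi (R : realType) (D : set (probability R R))
    (m : probability R R) : \bar R :=
  ereal_sup [set (\int[nu]_z (z.1 * z.2)%:E)%E | nu in couplings m D].

Definition atom (d : measure_display) (T : measurableType d) (R : realType)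
    (P : probability T R) (A : set T) : Prop :=
  [/\ measurable A, (0 < P A)%E &
      forall B : set T, measurable B -> B `<=` A -> P B = 0%E \/ P B = P A].

Definition nonatomic (d : measure_display) (T : measurableType d)
    (R : realType) (P : probability T R) : Prop :=
  forall A : set T, ~ atom P A.

Section risk_measure.
Context (d : measure_display) (T : measurableType d) (R : realType).
Context (P : probability T R) (p : \bar R) (p1 : (1 <= p)%E).

Lemma Lfun_cst_probability (a : R) : (cst a : T -> R) \in Lfun P p.
Proof.
apply/andP; split; rewrite inE/=; first exact: measurable_cst.
rewrite /finite_norm unlock; case: p p1 => [r r1|_|//] /=.
- rewrite (_ : (fun _ => _) = cst (`|a| `^ r)%:E)//.
  by rewrite integral_cst//= probability_setT mule1 poweR_EFin ltry.
- rewrite probability_setT lte01.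
  by rewrite (_ : _ \o _ = cst `|a|%:E)// ess_sup_cst ?ltry// [X in (_ < X)%E]probability_setT lte01.
Qed.

Definition Lconst (a : R) : LfunType P p1 :=
  Lfun_Sub p1 (Lfun_cst_probability a).

(* Random variables are functions, not classes modulo almost sure equality;
   monotone_ae below makes a coherent rho constant on these classes. *)
Implicit Types (rho : LfunType P p1 -> R) (X : LfunType P p1).

Definition translation_equivariant rho : Prop :=
  forall X (a : R), rho (X + Lconst a) = rho X + a.

Definition pos_homogeneous rho : Prop :=
  forall X (delta : R), 0 <= delta -> rho (delta *: X) = delta * rho X.

Definition monotone_ae rho : Prop :=
  forall X1 X2 : LfunType P p1, (\forall w \ae P, X1 w <= X2 w) -> rho X1 <= rho X2.

Definition convex_risk rho : Prop :=
  forall (X1 X2 : LfunType P p1) (theta : R), 0 <= theta <= 1 ->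
    rho ((1 - theta) *: X1 + theta *: X2)
      <= (1 - theta) * rho X1 + theta * rho X2.

Definition coherent rho : Prop :=
  [/\ translation_equivariant rho, pos_homogeneous rho,
      monotone_ae rho & convex_risk rho].

Definition law_invariant rho : Prop :=
  forall X1 X2 : LfunType P p1, same_measure (distribution P X1) (distribution P X2) ->
    rho X1 = rho X2.

Definition cvg_in_probability (X_ : nat -> LfunType P p1)
    (X : LfunType P p1) : Prop :=
  forall eps : R, 0 < eps ->
    P [set w | eps <= `|X_ n w - X w|] @[n --> \oo] --> 0%E.

(* Meaningful for p = +oo. *)
Definition fatou_property rho : Prop :=
  forall (X_ : nat -> LfunType P p1) (X : LfunType P p1),
    (exists M : R, forall n, ('N[P]_+oo[EFin \o X_ n] <= M%:E)%E) ->
    cvg_in_probability X_ X ->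
    ((rho X)%:E <= limn_einf (fun n => (rho (X_ n))%:E))%E.

End risk_measure.

(* Main.v *)
Require Import Defs.
From HB Require Import structures.
From mathcomp Require Import all_boot all_order all_algebra.
From mathcomp Require Import all_classical all_reals all_analysis.
From mathcomp Require Import measurable_realfun ess_sup_inf ring lra.

(** The representing set consists of the laws of the dual densities of [rho]: the bounded
    nonnegative variables [Z] of mean 1 on the given space such that E(YZ) <= rho(Y) for
    every nonnegative [Y] ([dual_density]). The representation rests on two facts.

    The first is that a dual density satisfies more than E(XZ) <= rho(X): the integral of
    [xy] against any coupling of the laws of [X] and [Z] is at most rho(X)
    ([dual_density_coupling]). Up to monotone approximation, both coordinates take
    finitely many values, so that the coupling is a matrix of weights. On a nonatomic
    space every event can be cut into pieces of prescribed probabilities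
    ([nonatomic_split], from Sierpinski's theorem), and cutting the level sets of the
    discretized [Z] according to the weights yields a variable [Y] with the law of the
    discretized [X] and coupled to the discretized [Z] as prescribed. The bound then reads
    E(YZ) <= rho(Y), and rho(Y) <= rho(X) by law invariance and monotonicity.

    The second is that for each [X] some dual density nearly attains rho(X)
    ([dual_density_attaining]). Approximate [X] by a step function, constant on the cells
    of a finite partition. On the finite-dimensional space of functions constant on the
    cells, [finite_hahn_banach] gives a linear functional below [rho] that equals [rho] at
    the step function; its density [Z] with respect to the probabilities of the cells is a
    step function. That E(YZ) <= rho(Y) holds for all nonnegative [Y], and not only for
    those constant on the cells, is the dilatation monotonicity of [rho]: averaging [Y]
    over each cell does not increase the risk, because such an average is a limit of means
    of rearrangements of [Y] inside the cells ([step_density_bounded_le]).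

    Both facts need only that the risk of the excess of |X| over a level [M] tends to 0
    as [M] grows ([coherent_tail]). For [p = +oo] the excess vanishes almost surely for [M]
    large. For finite [p] it tends to 0 in norm, and a coherent risk measure is
    automatically bounded on the unit ball ([coherent_bounded_unit_ball]). This last bound
    also gives the uniform bound on the moments of the representing laws
    ([dual_law_moment]), by duality of the norms. *)

Set Implicit Arguments.
Unset Strict Implicit.
Unset Printing Implicit Defensive.

Import Order.TTheory GRing.Theory Num.Theory.
Import numFieldNormedType.Exports.

Local Open Scope classical_set_scope.
Local Open Scope ring_scope.

(** * Probabilities as real numbers *)

Section real_probability.
Context (d : measure_display) (T : measurableType d) (R : realType).
Context (P : probability T R).

Definition prob (A : set T) : R := fine (P A).

Lemma probE A : measurable A -> P A = (prob A)%:E.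
Proof. by move=> mA; rewrite /prob fineK// fin_num_measure. Qed.

Lemma prob_ge0 A : 0 <= prob A. Proof. exact: fine_ge0. Qed.

Lemma prob_le A B : measurable A -> measurable B -> A `<=` B ->
  prob A <= prob B.
Proof.
by move=> mA mB AB; rewrite -lee_fin -!probE//; apply: le_measure; rewrite ?inE.
Qed.

Lemma probT : prob setT = 1.
Proof. by rewrite /prob probability_setT. Qed.

Lemma prob0 : prob set0 = 0.
Proof. by rewrite /prob measure0. Qed.

Lemma prob_le1 A : measurable A -> prob A <= 1.
Proof. by move=> mA; rewrite -probT; exact: prob_le. Qed.

Lemma probU A B : measurable A -> measurable B -> A `&` B = set0 ->
  prob (A `|` B) = prob A + prob B.
Proof.
move=> mA mB AB; apply: EFin_inj; rewrite EFinD -!probE//; last exact: measurableU.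
exact: measureU.
Qed.

Lemma probD A B : measurable A -> measurable B -> B `<=` A ->
  prob (A `\` B) = prob A - prob B.
Proof.
move=> mA mB BA; apply/eqP; rewrite -subr_eq opprK -probU//; last 2 first.
- exact: measurableD.
- by rewrite setDE -setIA setICl setI0.
by rewrite setUC setDUK.
Qed.

Lemma cvg_prob_nondecreasing (F : nat -> set T) :
  (forall n, measurable (F n)) -> nondecreasing_seq F ->
  prob (F n) @[n --> \oo] --> prob (\bigcup_n F n).
Proof.
move=> mF ndF; have mU : measurable (\bigcup_n F n) by exact: bigcupT_measurable.
apply: fine_cvg; rewrite -probE//.
exact: nondecreasing_cvg_mu.
Qed.

Lemma cvg_prob_nonincreasing (F : nat -> set T) :
  (forall n, measurable (F n)) -> nonincreasing_seq F ->
  prob (F n) @[n --> \oo] --> prob (\bigcap_n F n).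
Proof.
move=> mF ndF; have mU : measurable (\bigcap_n F n) by exact: bigcapT_measurable.
apply: fine_cvg; rewrite -probE//.
apply: nonincreasing_cvg_mu => //.
by rewrite (le_lt_trans (probability_le1 P (mF 0%N)))// ltry.
Qed.

End real_probability.

(** * Intermediate values of a nonatomic probability *)

Section nonatomic.
Context (d : measure_display) (T : measurableType d) (R : realType).
Context (P : probability T R) (Pna : nonatomic P).
Local Notation prob := (prob P).

(** An event that is not an atom splits into two parts of positive probability,
    and the smaller of them does the job. *)
Lemma nonatomic_halving A : measurable A -> 0 < prob A ->
  exists B, [/\ measurable B, B `<=` A & 0 < prob B <= prob A / 2].
Proof.
move=> mA A0; have [B [mB BA B0 BnA]] : exists B, [/\ measurable B, B `<=` A,
    prob B <> 0 & prob B <> prob A].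
  apply: contrapT => nB; apply: (Pna (A := A)); split => //.
    by rewrite probE// lte_fin.
  move=> B mB BA; apply: contrapT => /not_orP[B0 BnA].
  apply: nB; exists B; split => // e.
    by apply: B0; rewrite probE// e.
  by apply: BnA; rewrite !probE// e.
have B_ge0 := prob_ge0 P B.
have BleA := prob_le P mB mA BA.
have [h|h] := lerP (prob B) (prob A / 2).
  by exists B; split => //; rewrite h lt_neqAle eq_sym B_ge0 andbT; apply/andP; split => //; apply/eqP.
exists (A `\` B); split; [exact: measurableD|exact: subDsetl|].
rewrite probD//; apply/andP; split; last by lra.
by rewrite subr_gt0 lt_neqAle BleA andbT; apply/eqP.
Qed.

Lemma nonatomic_small_subset A (e : R) : measurable A -> 0 < prob A -> 0 < e ->
  exists B, [/\ measurable B, B `<=` A & 0 < prob B < e].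
Proof.
move=> mA A0 e0.
have H n : exists B, [/\ measurable B, B `<=` A & 0 < prob B <= (1/2) ^+ n].
  elim: n => [|n [B [mB BA /andP[B0 Bn]]]].
    by exists A; split => //; rewrite A0 expr0 prob_le1.
  have [C [mC CB /andP[C0 CB2]]] := nonatomic_halving mB B0.
  exists C; split => //; first exact: subset_trans CB BA.
  by rewrite C0 exprS (le_trans CB2)//; lra.
have /cvgrPdist_lt/(_ _ e0)[n _ /(_ n)] : (1/2) ^+ n @[n --> \oo] --> (0 : R).
  by apply: cvg_expr; rewrite ger0_norm; lra.
rewrite /= leqnn => /(_ isT); rewrite sub0r normrN ger0_norm; last first.
  by rewrite exprn_ge0//; lra.
move=> ne; have [B [mB BA /andP[B0 Bn]]] := H n.
by exists B; split => //; rewrite B0 (le_lt_trans Bn).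
Qed.

(** Sierpinski's theorem. Exhaust [A] greedily from inside: each step adds a piece
    at least half as large as the largest one that keeps the total below [b]. If
    the limit fell short of [b], a small event of [nonatomic_small_subset] would
    have been admissible at every step, so that every step would have added at
    least half of its probability, which is impossible. *)
Lemma nonatomic_intermediate_value A (b : R) : measurable A -> 0 <= b <= prob A ->
  exists B, [/\ measurable B, B `<=` A & prob B = b].
Proof.
move=> mA /andP[b0 bA].
pose good B := [/\ measurable B, B `<=` A & prob B <= b].
pose feasible B C := [/\ measurable C, C `<=` A `\` B & prob C <= b - prob B].
have /choice[F HF] : forall B, exists C, good B -> feasible B C /\
    forall C', feasible B C' -> prob C' <= 2 * prob C.
  move=> B.
  have [gB|] := pselect (good B); last by exists set0.
  have f0 : feasible B set0.
    by case: gB => mB BA Bb; split; [exact: measurable0|exact: sub0set|rewrite prob0 subr_ge0].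
  pose S := [set prob C | C in feasible B].
  have hS : has_sup S.
    split; first by exists (prob set0); exists set0.
    by exists 1 => _ [C [mC _ _] <-]; exact: prob_le1.
  have S0 : 0 <= sup S.
    by rewrite -(prob0 P); apply: ub_le_sup; [exact: hS.2|exists set0].
  have [S_gt0|S_le0] := ltP 0 (sup S).
    have [_ [C fC <-] hC] := sup_adherent (divr_gt0 S_gt0 (ltr0n R 2)) hS.
    exists C => _; split => // C' fC'.
    have : prob C' <= sup S by apply: ub_le_sup; [exact: hS.2|exists C'].
    by lra.
  exists set0 => _; split => // C' fC'; rewrite prob0 mulr0 (le_trans _ S_le0)//.
  by apply: ub_le_sup; [exact: hS.2|exists C'].
pose B_ n := iter n (fun B => B `|` F B) set0.
have gB n : good (B_ n).
  elim: n => [|n gn]; first by split; [exact: measurable0|exact: sub0set|rewrite prob0].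
  have [[mF FA Fb] _] := HF _ gn; case: gn => mB BA Bb.
  have BF0 : B_ n `&` F (B_ n) = set0.
    by rewrite -subset0 => x [Bx /FA[]].
  split => /=; [exact: measurableU| |by rewrite probU//; lra].
  by move=> x [/BA//|/FA[]].
have BS n : prob (B_ n.+1) = prob (B_ n) + prob (F (B_ n)).
  have [[mF FA Fb] _] := HF _ (gB n); have [mB BA Bb] := gB n.
  by rewrite /= probU// -subset0 => x [Bx /FA[]].
have ndB : nondecreasing_seq B_.
  by apply/nondecreasing_seqP => n; apply/subsetPset => x Bx; left.
have mB n : measurable (B_ n) by case: (gB n).
pose B := \bigcup_n B_ n.
have mBU : measurable B by exact: bigcupT_measurable.
have BA : B `<=` A by move=> x [n _ Bx]; case: (gB n) => _ + _; exact.
have Bb : prob B <= b.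
  have cB := @cvg_prob_nondecreasing _ _ _ P _ mB ndB.
  apply: (cvgr_to_le cB).
  by apply: nearW => n; case: (gB n).
exists B; split => //; apply/eqP; rewrite eq_le Bb /= leNgt; apply/negP => ltb.
have [C [mC CD /andP[C0 Cb]]] : exists C, [/\ measurable C, C `<=` A `\` B &
    0 < prob C < b - prob B].
  apply: nonatomic_small_subset; [exact: measurableD| |by rewrite subr_gt0].
  by rewrite probD//; lra.
have fC n : prob C <= 2 * prob (F (B_ n)).
  apply: (HF _ (gB n)).2; split => //.
    by move=> x /CD[Ax nBx]; split => // Bx; apply: nBx; exists n.
  rewrite (le_trans (ltW Cb))// lerB//; apply: prob_le => //.
  exact: bigcup_sup.
have Bn n : n%:R * (prob C / 2) <= prob (B_ n).
  elim: n => [|n IHn]; first by rewrite mul0r prob_ge0.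
  by rewrite BS -natr1 mulrDl; have := fC n; lra.
have := Bn (Num.truncn (2 / prob C)).+1.
have := truncnS_gt (2 / prob C).
rewrite ltr_pdivrMr// => h1 h2; have := prob_le1 P (mB (Num.truncn (2 / prob C)).+1).
lra.
Qed.

Lemma nonatomic_between A B (b : R) : measurable A -> measurable B ->
  A `<=` B -> prob A <= b <= prob B ->
  exists C, [/\ measurable C, A `<=` C, C `<=` B & prob C = b].
Proof.
move=> mA mB AB /andP[Ab bB].
have [|C [mC CD Cb]] := @nonatomic_intermediate_value (B `\` A) (b - prob A)
  (measurableD mB mA).
  by rewrite probD//; lra.
exists (A `|` C); split; [exact: measurableU|by left|by move=> x [/AB|/CD[]]|].
by rewrite probU// ?Cb ?subrKC// -subset0 => x [Ax /CD[]].
Qed.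

End nonatomic.

(** * Maps with measurable fibres *)

Section finitely_valued.
Context (d : measure_display) (T : measurableType d).

(** Step functions are written [c \o k], with [k] valued in a finite type and [c] the
    vector of values: passing to a finer partition, permuting the cells, averaging
    over them and solving for weights are then operations on [c] and on indices. *)
Definition measurable_fibers (I : Type) (k : T -> I) : Prop :=
  forall i, measurable (k @^-1` [set i]).

Lemma preimage_bigcup_fibers (I : Type) (k : T -> I) (A : set I) :
  k @^-1` A = \bigcup_(i in A) k @^-1` [set i].
Proof. by apply/seteqP; split=> [x Ax|x [i Ai /= ->]//]; exists (k x). Qed.

Lemma measurable_preimage_fibers (I : finType) (k : T -> I) (A : set I) :
  measurable_fibers k -> measurable (k @^-1` A).
Proof.
move=> mk; rewrite preimage_bigcup_fibers.
by apply: fin_bigcup_measurable => // i _; exact: mk.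
Qed.

Lemma measurable_fibers_comp (I : finType) (J : Type) (k : T -> I) (g : I -> J) :
  measurable_fibers k -> measurable_fibers (g \o k).
Proof. by move=> mk j; rewrite comp_preimage; exact: measurable_preimage_fibers. Qed.

Lemma measurable_fibers_comp_nat (J : Type) (k : T -> nat) (g : nat -> J) :
  measurable_fibers k -> measurable_fibers (g \o k).
Proof.
move=> mk j; rewrite comp_preimage preimage_bigcup_fibers.
by apply: bigcup_measurable => i _; exact: mk.
Qed.

(** Refines the partition by [k], each cell being cut by its own map. *)
Lemma measurable_fibers_glue (I J : Type) (k : T -> I) (h : I -> T -> J) :
  measurable_fibers k -> (forall i, measurable_fibers (h i)) ->
  measurable_fibers (fun x => (k x, h (k x) x)).
Proof.
move=> mk mh [i j].
rewrite [X in measurable X](_ : _ = k @^-1` [set i] `&` h i @^-1` [set j]).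
  by apply: measurableI; [exact: mk|exact: mh].
by apply/seteqP; split=> x /= [-> ->].
Qed.

Lemma measurable_fibers_if (I : Type) (A : set T) (k : T -> I) (m : I) :
  measurable A -> measurable_fibers k ->
  measurable_fibers (fun x => if x \in A then k x else m).
Proof.
move=> mA mk i.
rewrite [X in measurable X](_ : _ =
    (A `&` k @^-1` [set i]) `|` (~` A `&` [set _ | m = i])).
  apply: measurableU; apply: measurableI => //; first exact: measurableC.
  have [mi|mi] := pselect (m = i).
    by rewrite (_ : [set _ | _] = setT)//; apply/seteqP; split.
  by rewrite (_ : [set _ | _] = set0)//; apply/seteqP; split.
apply/seteqP; split=> x /=.
  by case: ifPn => [/set_mem Ax <-|/negP Ax <-]; [left|right; split=> // /mem_set].
by move=> [[Ax <-]|[nAx <-]]; [rewrite mem_set|rewrite memNset].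
Qed.

Lemma measurable_fibers_precomp (d' : measure_display) (S : measurableType d')
    (I : Type) (f : S -> T) (k : T -> I) :
  measurable_fun setT f -> measurable_fibers k -> forall i,
  measurable ((k \o f) @^-1` [set i]).
Proof.
move=> mf mk i.
by rewrite comp_preimage -[X in measurable X]setTI; exact: mf.
Qed.

Lemma measurable_fun_fibers (R : realType) (I : finType) (k : T -> I) (c : I -> R) :
  measurable_fibers k -> measurable_fun setT (c \o k).
Proof.
by move=> mk _ B mB; rewrite setTI comp_preimage; exact: measurable_preimage_fibers.
Qed.

End finitely_valued.

(** * Cutting events of a nonatomic space *)

Section splitting.
Context (d : measure_display) (T : measurableType d) (R : realType).
Context (P : probability T R) (Pna : nonatomic P).
Local Notation prob := (prob P).

Lemma nonatomic_split_nat n A (w : nat -> R) : measurable A ->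
  (forall i, 0 <= w i) -> prob A = \sum_(i < n.+1) w i ->
  exists k : T -> nat, [/\ measurable_fibers k, (forall x, k x < n.+1)%N &
    forall i, (i < n.+1)%N -> prob (A `&` k @^-1` [set i]) = w i].
Proof.
elim: n A => [|n IHn] A mA w0 Aw.
  exists (fun=> 0%N); split => // [i|[]//= _].
    have [->|i0] := eqVneq i 0%N.
      by rewrite (_ : _ @^-1` _ = setT)//; apply/seteqP; split.
    rewrite (_ : _ @^-1` _ = set0)//; apply/seteqP; split => // x /= i0'.
    by rewrite -i0' eqxx in i0.
  rewrite (_ : _ @^-1` _ = setT) ?setIT; last by apply/seteqP; split.
  by rewrite Aw big_ord1.
have [|B [mB BA BE]] := @nonatomic_intermediate_value _ _ _ _ Pna A
    (\sum_(i < n.+1) w i) mA.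
  by rewrite sumr_ge0//= Aw [leRHS]big_ord_recr lerDl.
have [k [mk kn kw]] := IHn B mB w0 BE.
exists (fun x => if x \in B then k x else n.+1); split.
- exact: measurable_fibers_if.
- by move=> x; case: ifP => // _; rewrite ltnS ltnW.
- move=> i; rewrite ltnS leq_eqVlt => /orP[/eqP ->|i_lt].
    rewrite (_ : _ `&` _ = A `\` B).
      by rewrite probD// BE Aw [X in X - _]big_ord_recr/= addrAC subrr add0r.
    apply/seteqP; split => x [Ax] /=.
      case: ifPn => [_ kE|/negP nB _]; first by have := kn x; rewrite kE ltnn.
      by split => // /mem_set.
    by move=> nB; split => //; rewrite memNset.
  rewrite (_ : _ `&` _ = B `&` k @^-1` [set i]) ?kw//.
  apply/seteqP; split => x [Ax] /=.
    case: ifPn => [/set_mem Bx|_ iE]; first by [].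
    by rewrite -iE ltnn in i_lt.
  by move=> kx; rewrite mem_set//; split => //; exact: BA.
Qed.

(** The source of all constructions on the underlying space: an event can be cut
    according to any prescribed weights. *)
Lemma nonatomic_split (n : nat) A (w : 'I_n.+1 -> R) : measurable A ->
  (forall i, 0 <= w i) -> prob A = \sum_i w i ->
  exists k : T -> 'I_n.+1, measurable_fibers k /\
    forall i, prob (A `&` k @^-1` [set i]) = w i.
Proof.
move=> mA w0 Aw.
have [||k [mk kn kw]] := @nonatomic_split_nat n A (fun i => w (inord i)) mA.
- by move=> i; exact: w0.
- by rewrite Aw; apply: eq_bigr => i _; rewrite inord_val.
have kE (i : 'I_n.+1) : (inord \o k) @^-1` [set i] = k @^-1` [set nat_of_ord i].
  apply/seteqP; split => x /=; first by move=> <-; rewrite inordK ?kn.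
  by move=> ->; rewrite inord_val.
exists (inord \o k); split => i; rewrite kE; first exact: mk.
by rewrite kw// inord_val.
Qed.

(** The [b]-quantile of [Y] on [A]. With [t] the least level such that [Y <= t] has
    probability at least [b] in [A], the event [Y < t] has probability at most [b];
    the level set [Y = t] may carry mass, and is cut so as to reach [b] exactly. *)
Lemma quantile_cut A (Y : T -> R) (lo hi b : R) : measurable A ->
  measurable_fun setT Y -> (forall x, A x -> lo <= Y x <= hi) ->
  0 <= b <= prob A ->
  exists C t, [/\ measurable C, C `<=` A, prob C = b,
    (forall x, C x -> Y x <= t) & (forall x, A x -> ~ C x -> t <= Y x)].
Proof.
move=> mA mY AY /andP[]; rewrite le_eqVlt => /predU1P[<- _|b0 bA].
  exists set0, lo; split => //; first exact: prob0.
  by move=> x /AY/andP[].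
pose F t := A `&` [set x | Y x <= t].
have mF t : measurable (F t).
  apply: measurableI => //; rewrite -[X in measurable X]setTI.
  exact: measurable_fun_le.
have FS s t : s <= t -> F s `<=` F t.
  by move=> st x [Ax /= Yx]; split => //=; exact: le_trans st.
pose S := [set t | b <= prob (F t)].
have Slo t : S t -> lo <= t.
  move=> St; rewrite leNgt; apply/negP => tlo; move: St; rewrite /S /=.
  rewrite (_ : F t = set0) ?prob0 ?leNgt ?b0// -subset0 => x [/AY/andP[+ _] /= h].
  by move=> /(lt_le_trans tlo); rewrite ltNge h.
have hS : has_inf S.
  split; last by exists lo => t /Slo.
  exists hi; rewrite /S /= (_ : F hi = A)//; apply/seteqP; split => [x []//|x Ax].
  by split => //=; case/andP: (AY _ Ax).
pose t := inf S.
have St s : t < s -> S s.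
  move=> /inf_lt-/(_ hS.1)[u Su us]; apply: (le_trans Su); apply: prob_le => //.
  exact/FS/ltW.
have bF : b <= prob (F t).
  have -> : F t = \bigcap_n F (t + n.+1%:R^-1).
    apply/seteqP; split => x.
      by move=> Fx n _; apply: FS Fx; rewrite lerDl.
    move=> h; split; first by case: (h 0%N I).
    rewrite /= leNgt; apply/negP => /ltr_add_invr[n].
    by rewrite ltNge; case: (h n I) => _ /= ->.
  have := @cvg_prob_nonincreasing _ _ _ P (fun n => F (t + n.+1%:R^-1)).
  move=> /(_ (fun n => mF _)) c.
  apply: (cvgr_to_ge (c _)).
    move=> m n mn; apply/subsetPset; apply: FS; rewrite lerD2l lef_pV2 ?posrE//.
    by rewrite ler_nat ltnS.
  by apply: nearW => n; apply: St; rewrite ltrDl.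
pose G := \bigcup_n F (t - n.+1%:R^-1).
have mG : measurable G by apply: bigcupT_measurable.
have GE x : G x <-> A x /\ Y x < t.
  split=> [[n _ [Ax /= Yx]]|[Ax]].
    by split => //; rewrite (le_lt_trans Yx)// ltrBlDr ltrDl.
  move=> /ltr_add_invr[n Yn]; exists n => //; split => //=.
  by rewrite lerBrDr ltW.
have Gb : prob G <= b.
  have := @cvg_prob_nondecreasing _ _ _ P (fun n => F (t - n.+1%:R^-1)).
  move=> /(_ (fun n => mF _)) c.
  apply: (cvgr_to_le (c _)).
    move=> m n mn; apply/subsetPset; apply: FS.
    by rewrite lerD2l lerN2 lef_pV2 ?posrE// ler_nat ltnS.
  apply: nearW => n; rewrite leNgt; apply/negP => /ltW h.
  have : t <= t - n.+1%:R^-1 by apply: ge_inf => //; case: hS.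
  by rewrite leNgt ltrBlDr ltrDl invr_gt0 ltr0Sn.
(* The level set [Y = t] is the gap between [G] and [F t]. *)
have [||C [mC GC CF Cb]] := @nonatomic_between _ _ _ _ Pna G (F t) b mG (mF t).
- by move=> x /GE[Ax /ltW].
- by rewrite Gb.
exists C, t; split => //.
- by move=> x /CF[].
- by move=> x /CF[].
- by move=> x Ax nC; rewrite leNgt; apply/negP => Yt; apply/nC/GC/GE.
Qed.

(** Cuts [A] into pieces of equal probability in the order of increasing [Y]. On the
    piece [i] the values of [Y] lie between [t i] and [t i.+1], hence the lower and
    upper step functions of this partition have integrals that differ, by
    telescoping, only by [(hi - lo) * h]. *)
Lemma quantile_equipartition_nat n A (Y : T -> R) (lo hi h : R) : measurable A ->
  measurable_fun setT Y -> (forall x, A x -> lo <= Y x <= hi) -> 0 <= h ->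
  prob A = n.+1%:R * h ->
  exists (k : T -> nat) (t : nat -> R), [/\ measurable_fibers k,
    (forall x, A x -> (k x < n.+1)%N /\ t (k x) <= Y x <= t (k x).+1),
    (forall i, (i < n.+1)%N -> prob (A `&` k @^-1` [set i]) = h),
    t 0%N = lo & t n.+1 = hi].
Proof.
move=> + mY + h0; elim: n A hi => [|n IHn] A hi mA AY Ah.
  exists (fun=> 0%N), (fun i => if i == 0%N then lo else hi); split => //.
  - move=> i; have [->|i0] := eqVneq i 0%N.
      by rewrite (_ : _ @^-1` _ = setT)//; apply/seteqP; split.
    rewrite (_ : _ @^-1` _ = set0)//; apply/seteqP; split => // x /= i0'.
    by rewrite -i0' eqxx in i0.
  - by move=> x Ax; split => //=; exact: AY.
  - move=> [|//] _.
    rewrite (_ : _ @^-1` _ = setT) ?setIT; last by apply/seteqP; split.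
    by rewrite Ah mul1r.
have [|B [s [mB BA BE Bs ABs]]] := @quantile_cut A Y lo hi (n.+1%:R * h) mA mY AY.
  by rewrite mulr_ge0//= Ah ler_wpM2r// ler_nat.
have [|k [t [mk kt kh t0 tn]]] := IHn B s mB _ BE.
  by move=> x Bx; rewrite Bs// andbT; case/andP: (AY _ (BA _ Bx)).
exists (fun x => if x \in B then k x else n.+1),
  (fun i => if (i <= n.+1)%N then t i else hi); split.
- exact: measurable_fibers_if.
- move=> x Ax; case: ifPn => [/set_mem Bx|/negP nBx].
    by have [kx tx] := kt _ Bx; split; [exact: ltnW|rewrite kx (ltnW kx)].
  rewrite leqnn ltnn tn ltnSn ABs//; last by move=> /mem_set.
  by split => //=; case/andP: (AY _ Ax).
- move=> i; rewrite ltnS leq_eqVlt => /orP[/eqP ->|i_lt].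
    rewrite (_ : _ `&` _ = A `\` B).
      by rewrite probD// BE Ah -natr1; ring.
    apply/seteqP; split => x [Ax] /=.
      case: ifPn => [/set_mem Bx kE|/negP nB _].
        by have [] := kt _ Bx; rewrite kE ltnn.
      by split => // /mem_set.
    by move=> nB; split => //; rewrite memNset.
  rewrite (_ : _ `&` _ = B `&` k @^-1` [set i]) ?kh//.
  apply/seteqP; split => x [Ax] /=.
    case: ifPn => [/set_mem Bx|_ iE]; first by [].
    by rewrite -iE ltnn in i_lt.
  by move=> kx; rewrite mem_set//; split => //; exact: BA.
- by [].
- by rewrite ltnn.
Qed.

End splitting.

(** * Integrals and step functions *)

Section integral_finitely_valued.
Context (d : measure_display) (T : measurableType d) (R : realType).
Context (P : probability T R).
Local Notation prob := (prob P).

Lemma integral_fibers (I : finType) (k : T -> I) (c : I -> R) :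
  measurable_fibers k ->
  (\int[P]_x (c (k x))%:E = (\sum_i c i * prob (k @^-1` [set i]))%:E)%E.
Proof.
move=> mk; rewrite -sumEFin.
transitivity (\int[P]_x (\sum_i (c i)%:E * (\1_(k @^-1` [set i]) x)%:E))%E.
  apply: eq_integral => x _; rewrite (bigD1 (k x))//= big1 ?adde0; last first.
    by move=> i ik; rewrite indicE memNset ?mule0//= => kx; rewrite kx eqxx in ik.
  by rewrite indicE mem_set// mule1.
rewrite integral_sum//; last first.
  by move=> i; apply: integrableZl => //; exact: integrable_indic.
apply: eq_bigr => i _; rewrite integralZl//; last exact: integrable_indic.
by rewrite integral_indic// setIT EFinM -probE.
Qed.

Lemma prob_preimage_fibers (I : finType) (k : T -> I) (A : set I) :
  measurable_fibers k ->
  prob (k @^-1` A) = \sum_(i | i \in A) prob (k @^-1` [set i]).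
Proof.
move=> mk; apply: EFin_inj; rewrite -probE; last exact: measurable_preimage_fibers.
rewrite -[k @^-1` A]setIT -integral_indic//; last exact: measurable_preimage_fibers.
rewrite (_ : (fun x => _) = (fun x => (\1_A (k x))%:E)); last first.
  by apply/funext => x; rewrite !indicE.
rewrite (integral_fibers (\1_A : I -> R) mk) [in RHS]big_mkcond/=; congr EFin.
by apply: eq_bigr => i _; rewrite indicE; case: ifP; rewrite ?mul1r ?mul0r.
Qed.

(** The law of total probability, read off the partition by [k] and [A] jointly. *)
Lemma prob_fibers_setI (I : finType) (k : T -> I) (A : set T) :
  measurable A -> measurable_fibers k ->
  prob A = \sum_i prob (A `&` k @^-1` [set i]).
Proof.
move=> mA mk; pose k' x := (k x, x \in A).
have mk' : measurable_fibers k'.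
  move=> [i b]; rewrite [X in measurable X](_ : _ =
      k @^-1` [set i] `&` (if b then A else ~` A)).
    by apply: measurableI => //; case: b => //; exact: measurableC.
  apply/seteqP; split => x /=.
    by case=> <- <-; split => //; case: ifPn => [/set_mem|/negP h1 /mem_set].
  by move=> [<-]; case: b => ?; [rewrite /k' mem_set|rewrite /k' memNset].
rewrite [in LHS](_ : A = k' @^-1` [set ij : I * bool | ij.2]); last first.
  by apply/seteqP; split => x /=; [move/mem_set|move/set_mem].
rewrite prob_preimage_fibers// (eq_bigl (fun ij : I * bool => ij.2)); last first.
  by move=> ij; apply/idP/idP => [/set_mem|h]; last exact: mem_set.
rewrite big_mkcond [LHS](_ : _ = \sum_i \sum_(b : bool)
    if b then prob (k' @^-1` [set (i, b)]) else 0).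
  apply: eq_bigr => i _; rewrite big_bool/= addr0.
  congr prob; apply/seteqP; split => x /=; first by case=> <- /set_mem.
  by case=> Ax <-; rewrite /k' mem_set.
by rewrite pair_bigA/=; apply: eq_bigr; case.
Qed.

End integral_finitely_valued.

Section simple_approximation.
Context (d d' : measure_display) (S : measurableType d) (U : measurableType d').
Context (R : realType) (nu : {measure set S -> \bar R}).
Import HBNNSimple.

(** Enumerates the range of [f]: [k] is the rank of the value in this enumeration. *)
Lemma nnsfun_fibers (f : {nnsfun U >-> R}) :
  exists n (k : U -> 'I_n.+1) (c : 'I_n.+1 -> R),
    [/\ measurable_fibers k, (forall i, 0 <= c i) & forall x, f x = c (k x)].
Proof.
have /finite_seqP[s fsE] : finite_set (range f) by [].
have fs x : f x \in s.
  have : range f (f x) by exists x.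
  by rewrite fsE.
exists (size s).-1, (fun x => inord (index (f x) s)), (fun i => nth 0 s i); split.
- move=> i; pose B := [set y | inord (index y s) = i :> 'I_(size s).-1.+1].
  rewrite [X in measurable X](_ : _ = \bigcup_(y in B `&` range f) f @^-1` [set y]).
    apply: fin_bigcup_measurable => //; exact: finite_setIr.
  apply/seteqP; split => x /=; first by move=> h; exists (f x).
  by case=> y [By _] /= ->.
- move=> i; have [si|si] := ltnP i (size s); last by rewrite nth_default.
  have : range f (nth 0 s i) by rewrite fsE; exact: mem_nth.
  by case=> x _ <-.
- move=> x; rewrite inordK ?nth_index//.
  by rewrite prednK ?index_mem//; case: (s) (fs x).
Qed.

(** Monotone convergence, in the form used to reduce an upper bound to step functions
    in one variable of a product at a time. *)
Lemma integral_le_simple (u : S -> U) (f : U -> R) (g : S -> R) (C : \bar R) :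
  measurable_fun setT u -> measurable_fun setT f -> (forall x, 0 <= f x) ->
  measurable_fun setT g -> (forall x, 0 <= g x) ->
  (forall n (k : U -> 'I_n.+1) (c : 'I_n.+1 -> R), measurable_fibers k ->
    (forall i, 0 <= c i) -> (forall x, c (k x) <= f x) ->
    (\int[nu]_x (c (k (u x)) * g x)%:E <= C)%E) ->
  (\int[nu]_x (f (u x) * g x)%:E <= C)%E.
Proof.
move=> mu mf f0 mg g0 H.
have mfE : measurable_fun setT (EFin \o f) by exact/measurable_EFinP.
pose h n := nnsfun_approx measurableT mfE n.
have hf x : (EFin \o (h ^~ x)) @ \oo --> (f x)%:E.
  by apply: cvg_nnsfun_approx => // y _; rewrite lee_fin.
have ndh x : nondecreasing_seq (fun n => h n x).
  by move=> m n mn; exact/lefP/nd_nnsfun_approx.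
have hle n x : h n x <= f x.
  rewrite -lee_fin; apply: (cvge_to_ge (hf x)).
  by exists n => // m /= nm; rewrite lee_fin; exact: ndh.
have mhg n : measurable_fun setT (fun x => (h n (u x) * g x)%:E).
  apply/measurable_EFinP/measurable_funM => //.
  exact: measurableT_comp.
rewrite [leLHS](_ : _ = \int[nu]_x limn (fun n => (h n (u x) * g x)%:E))%E; last first.
  apply: eq_integral => x _; apply/esym/cvg_lim => //.
  rewrite EFinM; under eq_fun do rewrite EFinM.
  by apply: cvgeZr => //; exact: hf.
rewrite monotone_convergence//; last 2 first.
- by move=> n x _; rewrite lee_fin mulr_ge0.
- by move=> x _ m n mn; rewrite lee_fin ler_wpM2r// ndh.
apply: lime_le.
  apply: ereal_nondecreasing_is_cvgn => m n mn; apply: ge0_le_integral => //.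
  - by move=> x _; rewrite lee_fin mulr_ge0.
  - by move=> x _; rewrite lee_fin ler_wpM2r// ndh.
apply: nearW => n; have [m [k [c [mk c0 hk]]]] := nnsfun_fibers (h n).
under eq_integral do rewrite hk.
by apply: (H _ _ _ mk c0) => x; rewrite -hk.
Qed.

End simple_approximation.

(** * A finite-dimensional Hahn-Banach theorem *)

Section sublinear.
Context (R : realType) (V : lmodType R).
Implicit Types (phi : V -> R) (u v x y : V).

Definition sublinear phi : Prop :=
  (forall x y, phi (x + y) <= phi x + phi y) /\
  (forall a x, 0 <= a -> phi (a *: x) = a * phi x).

(** The largest sublinear minorant of [phi] with value [- phi v] at [- v], that is, one
    that is linear along [v] and keeps the value [phi v]. *)
Definition line_minorant phi v y : R :=
  inf [set phi (y + t *: v) - t * phi v | t in [set t | 0 <= t]].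

Section line_minorant_theory.
Context (phi : V -> R) (phi_sub : sublinear phi) (v : V).
Local Notation m := (line_minorant phi v).

Lemma sublinear0 : phi 0 = 0.
Proof. by rewrite -(scale0r (0 : V)) phi_sub.2// mul0r. Qed.

Lemma sublinear_oppr x : 0 <= phi x + phi (- x).
Proof. by rewrite -sublinear0 -(subrr x) phi_sub.1. Qed.

Let has_inf_line y :
  has_inf [set phi (y + t *: v) - t * phi v | t in [set t | 0 <= t]].
Proof.
split; first by exists (phi (y + 0 *: v) - 0 * phi v); exists 0 => //=.
exists (- phi (- y)) => _ [t /= t0 <-].
have := phi_sub.1 (y + t *: v) (- y).
by rewrite addrAC subrr add0r phi_sub.2//; lra.
Qed.

Lemma line_minorant_le_at y t : 0 <= t -> m y <= phi (y + t *: v) - t * phi v.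
Proof. by move=> t0; apply: ge_inf; [exact: (has_inf_line y).2|exists t]. Qed.

Lemma le_line_minorant y a :
  (forall t, 0 <= t -> a <= phi (y + t *: v) - t * phi v) -> a <= m y.
Proof.
move=> h; apply: lb_le_inf; first exact: (has_inf_line y).1.
by move=> _ [t t0 <-]; exact: h.
Qed.

Lemma line_minorant_le y : m y <= phi y.
Proof. by have := line_minorant_le_at y (lexx 0); rewrite scale0r addr0 mul0r subr0. Qed.

Lemma line_minorantN : m (- v) <= - phi v.
Proof.
have := line_minorant_le_at (- v) ler01.
by rewrite scale1r addNr sublinear0 mul1r add0r.
Qed.

Lemma line_minorant_sublinear : sublinear m.
Proof.
have mZ a x : 0 < a -> m (a *: x) <= a * m x.
  move=> a0; rewrite mulrC -ler_pdivrMr//; apply: le_line_minorant => t t0.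
  rewrite ler_pdivrMr//.
  have := @line_minorant_le_at (a *: x) (a * t) (mulr_ge0 (ltW a0) t0).
  by rewrite -scalerA -scalerDr phi_sub.2 ?(ltW a0)//; lra.
split => [x y|a x]; last rewrite le_eqVlt => /predU1P[<-|a0].
- rewrite -lerBlDr; apply: le_line_minorant => t t0.
  rewrite lerBlDr -lerBlDl; apply: le_line_minorant => s s0.
  have := line_minorant_le_at (x + y) (addr_ge0 t0 s0).
  have := phi_sub.1 (x + t *: v) (y + s *: v).
  by rewrite addrACA -scalerDl mulrDl; lra.
- rewrite scale0r mul0r; apply/eqP; rewrite eq_le; apply/andP; split.
    by have := line_minorant_le 0; rewrite sublinear0.
  by apply: le_line_minorant => t t0; rewrite add0r phi_sub.2// subrr.
- apply/eqP; rewrite eq_le mZ//= mulrC -ler_pdivlMr// mulrC.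
  have := @mZ a^-1 (a *: x); rewrite scalerA mulVf ?gt_eqF// scale1r; apply.
  by rewrite invr_gt0.
Qed.

End line_minorant_theory.

(** The inequality [psi v + psi (- v) <= 0] says that [psi] is odd along [v]. It passes
    to minorants, so that making a minorant odd along one vector after the other
    never spoils what was gained before. *)
Lemma sublinear_odd_minorant phi (s : seq V) : sublinear phi ->
  exists psi, [/\ sublinear psi, (forall y, psi y <= phi y) &
    forall v, v \in s -> psi v + psi (- v) <= 0].
Proof.
elim: s phi => [|v s IHs] phi sphi; first by exists phi; split.
have [psi [spsi psi_le psis]] := IHs _ (line_minorant_sublinear sphi v).
exists psi; split => // [y|u].
  exact: (le_trans (psi_le y) (line_minorant_le sphi v y)).
rewrite inE => /predU1P[->|us]; last exact: psis.
have := psi_le v; have := psi_le (- v).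
by have := line_minorantN sphi v; have := line_minorant_le sphi v v; lra.
Qed.

Lemma sublinear_sum phi (I : Type) (r : seq I) (F : I -> V) : sublinear phi ->
  phi (\sum_(i <- r) F i) <= \sum_(i <- r) phi (F i).
Proof.
move=> sphi; elim: r => [|i r IHr]; first by rewrite !big_nil sublinear0.
by rewrite !big_cons (le_trans (sphi.1 _ _))// lerD2l.
Qed.

End sublinear.

(** A sublinear functional that is odd along a basis is linear; making it odd along [x]
    first keeps its value at [x]. *)
Lemma finite_hahn_banach (R : realType) (I : finType) (phi : {ffun I -> R^o} -> R)
    (x : {ffun I -> R^o}) : sublinear phi ->
  exists l : I -> R, (forall y : {ffun I -> R^o}, \sum_i l i * y i <= phi y) /\
    \sum_i l i * x i = phi x.
Proof.
move=> sphi; pose e i : {ffun I -> R^o} := [ffun j => (j == i)%:R].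
have [psi [spsi psi_le odd]] :=
  sublinear_odd_minorant (map e (enum I)) (line_minorant_sublinear sphi x).
have le_psi (y : {ffun I -> R^o}) : \sum_i psi (e i) * y i <= psi y.
  have yE : - y = \sum_i (- y i) *: e i.
    apply/ffunP => j; rewrite sum_ffunE !ffunE (bigD1 j)//= big1 ?addr0.
      by rewrite !ffunE eqxx /GRing.scale/= mulr1.
    by move=> i ij; rewrite !ffunE eq_sym (negbTE ij) /GRing.scale/= mulr0.
  have : psi (- y) <= - \sum_i psi (e i) * y i.
    rewrite yE (le_trans (sublinear_sum _ _ spsi))// -sumrN ler_sum// => i _.
    have := odd (e i) (map_f e (mem_enum _ i)).
    have [y0 h|/ltW y0 _] := lerP 0 (y i).
      by rewrite scaleNr -scalerN spsi.2//; nra.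
    by rewrite spsi.2 ?oppr_ge0//; lra.
  by have := sublinear_oppr spsi y; lra.
exists (fun i => psi (e i)); split => [y|].
  by rewrite (le_trans (le_psi y))// (le_trans (psi_le y))// line_minorant_le.
apply/eqP; rewrite eq_le (le_trans (le_psi x))/=; last first.
  by rewrite (le_trans (psi_le x))// line_minorant_le.
have := le_psi (- x); have := psi_le (- x); have := line_minorantN sphi x.
under [X in _ -> _ -> X <= _ -> _]eq_bigr do rewrite ffunE mulrN.
by rewrite sumrN; lra.
Qed.

(** * Law-invariant sublinear functionals *)

Section excess.
Context (d : measure_display) (T : measurableType d) (R : realType).
Implicit Types (f : T -> R) (M : R).

Definition excess f M : T -> R := fun w => Num.max (`|f w| - M) 0.

Lemma excess_ge0 f M w : 0 <= excess f M w.
Proof. by rewrite /excess le_max lexx orbT. Qed.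

Lemma excess_le f M w : 0 <= M -> excess f M w <= `|f w|.
Proof. by move=> M0; rewrite /excess ge_max normr_ge0 andbT gerBl. Qed.

Lemma measurable_excess f M : measurable_fun setT f -> measurable_fun setT (excess f M).
Proof.
move=> mf; apply: measurable_maxr => //; apply: measurable_funB => //.
exact: measurableT_comp.
Qed.

End excess.

Section risk_functional.
Context (d : measure_display) (T : measurableType d) (R : realType).
Context (P : probability T R).

(** The properties of a law-invariant coherent risk measure on a Lebesgue space that the
    duality argument uses, with plain functions instead of elements of the space. The
    exponent of the space appears only in [rf_tail], which reduces every question to
    bounded variables. *)
Record risk_functional (L : set (T -> R)) (phi : (T -> R) -> R) : Prop := {
  rf_measurable : forall X : T -> R, L X -> measurable_fun setT X;
  rf_bounded : forall (X : T -> R) K, measurable_fun setT X ->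
    (forall w, `|X w| <= K) -> L X;
  rf_dominated : forall X Y : T -> R, L Y -> measurable_fun setT X ->
    (forall w, `|X w| <= `|Y w|) -> L X;
  rf_add : forall X Y : T -> R, L X -> L Y -> L (fun w => X w + Y w);
  rf_scale : forall a (X : T -> R), L X -> L (fun w => a * X w);
  rf_le_ae : forall X Y : T -> R, L X -> L Y -> (\forall w \ae P, X w <= Y w) ->
    phi X <= phi Y;
  rf_subadditive : forall X Y : T -> R, L X -> L Y ->
    phi (fun w => X w + Y w) <= phi X + phi Y;
  rf_homogeneous : forall a (X : T -> R), 0 <= a -> L X -> phi (fun w => a * X w) = a * phi X;
  rf_cst : forall a, phi (fun=> a) = a;
  rf_law : forall X Y : T -> R, L X -> L Y ->
    (forall B, measurable B -> P (X @^-1` B) = P (Y @^-1` B)) -> phi X = phi Y;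
  rf_tail : forall (X : T -> R) (e : R), L X -> 0 < e ->
    exists2 M : R, 0 <= M & phi (excess X M) <= e }.

Context (L : set (T -> R)) (phi : (T -> R) -> R) (Lphi : risk_functional L phi).
Local Notation prob := (prob P).
Implicit Types X Y : T -> R.

Lemma rf_le X Y : L X -> L Y -> (forall w, X w <= Y w) -> phi X <= phi Y.
Proof. by move=> LX LY XY; apply: (rf_le_ae Lphi) => //; exact: aeW. Qed.

Lemma rf_Lcst a : L (fun=> a).
Proof. exact: (rf_bounded Lphi (K := `|a|)). Qed.

Lemma rf_Labs X : L X -> L (fun w => `|X w|).
Proof.
move=> LX; apply: (rf_dominated Lphi LX); last by move=> w; rewrite normr_id.
by apply: measurableT_comp => //; exact: (rf_measurable Lphi LX).
Qed.

Lemma rf_Lle X Y : L Y -> measurable_fun setT X -> (forall w, `|X w| <= Y w) -> L X.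
Proof.
move=> LY mX XY; apply: (rf_dominated Lphi LY mX) => w.
exact: le_trans (XY w) (ler_norm _).
Qed.

Lemma rf_Lexcess X (M : R) : L X -> 0 <= M -> L (excess X M).
Proof.
move=> LX M0; have mX := measurable_excess M (rf_measurable Lphi LX).
apply: (rf_dominated Lphi LX mX) => w.
by rewrite ger0_norm ?excess_ge0// excess_le.
Qed.

Lemma rf_Lfibers (I : finType) (k : T -> I) (c : I -> R) : measurable_fibers k ->
  L (c \o k).
Proof.
move=> mk; apply: (rf_bounded Lphi (K := \sum_i `|c i|)).
  exact: measurable_fun_fibers.
by move=> w; rewrite (bigD1 (k w))//= lerDl sumr_ge0.
Qed.

Lemma rf_law_fibers (I : finType) (k k' : T -> I) (c : I -> R) :
  measurable_fibers k -> measurable_fibers k' ->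
  (forall i, prob (k @^-1` [set i]) = prob (k' @^-1` [set i])) ->
  phi (c \o k) = phi (c \o k').
Proof.
move=> mk mk' kk'; apply: (rf_law Lphi); [exact: rf_Lfibers..|] => B mB.
rewrite -[LHS]/(P (k @^-1` (c @^-1` B))) -[RHS]/(P (k' @^-1` (c @^-1` B))).
rewrite !probE; [|exact: measurable_preimage_fibers..].
by rewrite !prob_preimage_fibers//; under eq_bigr do rewrite kk'.
Qed.

(** The functions of [k] form a finite-dimensional space on which [finite_hahn_banach]
    applies. *)
Lemma rf_sublinear_fibers (I : finType) (k : T -> I) : measurable_fibers k ->
  sublinear (fun y : {ffun I -> R^o} => phi (y \o k)).
Proof.
move=> mk; split=> [x y|a x a0].
  rewrite (_ : (x + y) \o k = (fun w => (x \o k) w + (y \o k) w)).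
    by apply: (rf_subadditive Lphi); exact: rf_Lfibers.
  by apply/funext => w /=; rewrite ffunE.
rewrite -(rf_homogeneous Lphi)//; last exact: rf_Lfibers.
by congr phi; apply/funext => w /=; rewrite ffunE.
Qed.

(** Only nonnegative [Y] are tested, so that the integral makes sense for every [Y] in
    [L]; [dual_density_coupling] extends the inequality to all of [L]. Boundedness of
    [Z] costs nothing, since step functions suffice to attain the risk, and it makes
    the powers of [Z] admissible test functions when moments are estimated. *)
Definition dual_density (Z : {mfun T >-> R}) : Prop :=
  [/\ forall w, 0 <= Z w, exists K, forall w, Z w <= K,
    (\int[P]_w (Z w)%:E = 1)%E &
    forall Y, L Y -> (forall w, 0 <= Y w) ->
      (\int[P]_w (Y w * Z w)%:E <= (phi Y)%:E)%E].

End risk_functional.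

(** * Couplings with a dual density *)

Section same_law.
Context (d d' : measure_display) (T : measurableType d) (S : measurableType d').
Context (R : realType) (P : probability T R) (nu : probability S R).
Implicit Types (x y : S -> R) (X Z : T -> R).

Definition same_law x X : Prop :=
  forall A, measurable A -> nu (x @^-1` A) = P (X @^-1` A).

Lemma ge0_integral_same_law x X (g : R -> \bar R) : measurable_fun setT x ->
  measurable_fun setT X -> measurable_fun setT g -> (forall u, 0 <= g u)%E ->
  same_law x X -> (\int[nu]_s g (x s) = \int[P]_w g (X w))%E.
Proof.
move=> mx mX mg g0 xX.
pose mxT : {mfun S >-> R} := mfun_Sub (mem_set mx).
pose mXT : {mfun T >-> R} := mfun_Sub (mem_set mX).
rewrite -(@ge0_integral_distribution _ _ _ _ _ nu mxT)//.
rewrite -(@ge0_integral_distribution _ _ _ _ _ P mXT)//.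
by apply: eq_measure_integral => A mA _; exact: xX.
Qed.

Lemma prob_same_law x X A : same_law x X -> measurable A ->
  prob nu (x @^-1` A) = prob P (X @^-1` A).
Proof. by move=> xX mA; rewrite /prob xX. Qed.

Context (Pna : nonatomic P) (L : set (T -> R)) (phi : (T -> R) -> R).
Context (Lphi : risk_functional P L phi).

(** The heart of the upper bound. Here [x] and [y] live on another space, have the laws
    of [X] and [Z], and are coupled arbitrarily. Replace [f (x s)] and [`|y s|] by step
    functions [c \o k] and [b \o h] below them: the coupling then matters only through
    the weights [w i j] of the cells. Each event [h (Z t) = i] is cut into pieces of
    probability [w i j], which defines a step variable [c \o k'] with the law of
    [c \o k \o X], coupled to [h \o Z] exactly as [c \o k \o x] is to [h \o y]. Now test
    [Z] against [c \o k'] and use law invariance. *)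
Lemma dual_density_coupling_ge0 (Z : {mfun T >-> R}) X x y (f : R -> R) :
  dual_density P L phi Z -> measurable_fun setT X ->
  measurable_fun setT x -> measurable_fun setT y ->
  same_law x X -> same_law y Z ->
  measurable_fun setT f -> (forall u, 0 <= f u) -> L (f \o X) ->
  (\int[nu]_s (f (x s) * `|y s|)%:E <= (phi (f \o X))%:E)%E.
Proof.
move=> [Z0 _ _ dZ] mX mx my xX yZ mf f0 LfX.
have mZ : measurable_fun setT Z by [].
apply: integral_le_simple => //; first exact: measurableT_comp.
move=> n k c mk c0 ck; under eq_integral do rewrite mulrC.
have mkx := measurable_fibers_precomp mx mk.
have mkX := measurable_fibers_precomp mX mk.
apply: (@integral_le_simple _ _ _ _ _ nu y (fun u => `|u|) (c \o (k \o x))) => //.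
- exact: measurable_fun_fibers.
- by move=> s; exact: c0.
move=> m h b mh b0 hb.
have mhy := measurable_fibers_precomp my mh.
have mhZ := measurable_fibers_precomp mZ mh.
pose w i j := prob nu ((h \o y) @^-1` [set i] `&` (k \o x) @^-1` [set j]).
have /choice[kk Hkk] i : exists k' : T -> 'I_n.+1, measurable_fibers k' /\
    forall j, prob P ((h \o Z) @^-1` [set i] `&` k' @^-1` [set j]) = w i j.
  apply: nonatomic_split => //; first by move=> j; exact: prob_ge0.
  rewrite comp_preimage -(prob_same_law yZ (mh i)) -comp_preimage.
  by rewrite (prob_fibers_setI nu (mhy i) mkx).
pose K' (t : T) := ((h \o Z) t, kk ((h \o Z) t) t).
have mK' : measurable_fibers K'.
  by apply: measurable_fibers_glue => // i; case: (Hkk i).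
pose K (s : S) := ((h \o y) s, (k \o x) s).
have mK : measurable_fibers K.
  by apply: (measurable_fibers_glue (h := fun _ => k \o x)).
have KK' ij : prob P (K' @^-1` [set ij]) = prob nu (K @^-1` [set ij]).
  case: ij => i j; transitivity (w i j).
    rewrite -(Hkk i).2; congr prob.
    by apply/seteqP; split => t; rewrite /K' /= => -[<- <-].
  by congr prob; apply/seteqP; split => t; rewrite /K /= => -[<- <-].
pose k' := snd \o K'.
have mk' : measurable_fibers k' by exact: measurable_fibers_comp.
apply: (@le_trans _ _ (\int[P]_t (c (k' t) * Z t)%:E)%E).
  rewrite (integral_fibers nu (fun ij => b ij.1 * c ij.2) mK).
  under eq_bigr do rewrite -KK'.
  rewrite -(integral_fibers P (fun ij => b ij.1 * c ij.2) mK').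
  apply: ge0_le_integral => //.
  - by move=> t _; rewrite lee_fin mulr_ge0.
  - apply/measurable_EFinP.
    exact: (measurable_fun_fibers (fun ij => b ij.1 * c ij.2) mK').
  - apply/measurable_EFinP; apply: measurable_funM => //.
    exact: (measurable_fun_fibers c mk').
  - move=> t _; rewrite lee_fin mulrC ler_wpM2l//.
    by rewrite -[leRHS]ger0_norm// hb.
apply: (@le_trans _ _ (phi (c \o k'))%:E).
  by apply: dZ => [|t]; [exact: (rf_Lfibers Lphi)|exact: c0].
rewrite lee_fin (rf_law_fibers Lphi (k' := k \o X))//.
  by apply: (rf_le Lphi) => //; [exact: (rf_Lfibers Lphi)|move=> t; exact: ck].
move=> j; rewrite comp_preimage -[RHS](prob_same_law xX (mk j)) -[x @^-1` _]comp_preimage.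
rewrite (prob_fibers_setI P (mk' j) mhZ) (prob_fibers_setI nu (mkx j) mhy).
apply: eq_bigr => i _; transitivity (prob P (K' @^-1` [set (i, j)])).
  congr prob; apply/seteqP; split => t; rewrite /k' /K' /=; first by move=> [<- <-].
  by move=> [<- <-].
rewrite KK'; congr prob; apply/seteqP; split => t; rewrite /K /=; first by move=> [<- <-].
by move=> [<- <-].
Qed.

End same_law.

Section dual_density_coupling.
Context (d d' : measure_display) (T : measurableType d) (S : measurableType d').
Context (R : realType) (P : probability T R) (nu : probability S R).
Context (Pna : nonatomic P) (L : set (T -> R)) (phi : (T -> R) -> R).
Context (Lphi : risk_functional P L phi).

(** For signed [X], the product is compared with that of [max (X, - M) + M], which is
    nonnegative. As [y] has mean 1, the shift by [M] cancels, and [phi] increases only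
    by the risk of the excess of [X] over the level [M]. *)
Lemma dual_density_coupling (Z : {mfun T >-> R}) (X : T -> R) (x y : S -> R) :
  dual_density P L phi Z -> L X ->
  measurable_fun setT x -> measurable_fun setT y ->
  same_law P nu x X -> same_law P nu y Z ->
  nu.-integrable setT (fun s => (x s * y s)%:E) /\
  (\int[nu]_s (x s * y s)%:E <= (phi X)%:E)%E.
Proof.
move=> dZ LX mx my xX yZ.
have mX := rf_measurable Lphi LX.
have mZ : measurable_fun setT Z by [].
have [Z0 _ Z1 _] := dZ.
have m_abs : measurable_fun setT (fun s => `|y s|) by exact: measurableT_comp.
have y1 : (\int[nu]_s `|y s|%:E = 1)%E.
  rewrite (@ge0_integral_same_law _ _ _ _ _ P nu y Z (fun u => `|u|%:E))//.
    by rewrite -Z1; apply: eq_integral => w _; rewrite ger0_norm.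
  by apply/measurable_EFinP; exact: normr_measurable.
have i_abs : nu.-integrable setT (fun s => `|y s|%:E).
  apply/integrableP; split; first exact/measurable_EFinP.
  by under eq_integral do rewrite /= normr_id; rewrite y1 ltry.
have y_ge0 : \forall s \ae nu, 0 <= y s.
  exists (y @^-1` `]-oo, 0[); split.
  - by rewrite -[X in measurable X]setTI; exact: my.
  - rewrite yZ// (_ : Z @^-1` _ = set0) ?measure0//.
    by rewrite -subset0 => w /=; rewrite in_itv/= ltNge Z0.
  - by move=> s /= /negP; rewrite -ltNge in_itv.
have xy_ae : ae_eq nu setT (fun s => (x s * y s)%:E) (fun s => (x s * `|y s|)%:E).
  by apply: filterS y_ge0 => s ys _; rewrite ger0_norm.
have mxy : measurable_fun setT (fun s => (x s * y s)%:E).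
  by apply/measurable_EFinP; apply: measurable_funM.
have mxay : measurable_fun setT (fun s => (x s * `|y s|)%:E).
  by apply/measurable_EFinP; apply: measurable_funM.
have pos (f : R -> R) : measurable_fun setT f -> (forall u, 0 <= f u) -> L (f \o X) ->
    (\int[nu]_s (f (x s) * `|y s|)%:E <= (phi (f \o X))%:E)%E.
  by move=> mf f0 LfX; apply: (dual_density_coupling_ge0 Pna Lphi dZ).
have ixy : nu.-integrable setT (fun s => (x s * y s)%:E).
  apply/integrableP; split => //.
  apply: (@le_lt_trans _ _ (phi (fun w => `|X w|))%:E); last exact: ltry.
  under eq_integral do rewrite /= normrM.
  by apply: (pos (fun u => `|u|)) => //; exact: (rf_Labs Lphi).
split => //.
have ixay : nu.-integrable setT (fun s => (x s * `|y s|)%:E).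
  apply: (le_integrable measurableT mxay _ ixy) => s _.
  by rewrite /= !normrM normr_id.
rewrite (ae_eq_integral (fun s => (x s * `|y s|)%:E))//.
apply/lee_addgt0Pr => e e0; rewrite -EFinD.
have [M M0 tailM] := rf_tail Lphi LX e0.
pose f u := Num.max u (- M) + M.
have f0 u : 0 <= f u by rewrite /f -lerBlDr sub0r le_max lexx orbT.
have mf : measurable_fun setT f.
  by apply: measurable_funD => //; exact: measurable_maxr.
have LaX := rf_Labs Lphi LX.
have LfX : L (f \o X).
  apply: (rf_Lle Lphi (rf_add Lphi LaX (rf_Lcst Lphi (2 * M)))).
    exact: measurableT_comp.
  move=> w; rewrite (ger0_norm (f0 (X w))) /f/=.
  have := ler_norm (X w); have := normr_ge0 (X w); rewrite /Num.max; case: ifP => _; lra.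
have fXE : phi (f \o X) <= phi X + e + M.
  have LW := rf_Lexcess Lphi LX M0.
  have LXW := rf_add Lphi LX LW.
  have := rf_subadditive Lphi LXW (rf_Lcst Lphi M).
  have := rf_subadditive Lphi LX LW.
  rewrite (rf_cst Lphi).
  suff : phi (f \o X) <= phi (fun w => X w + excess X M w + M) by lra.
  apply: (rf_le Lphi) => //; first exact: (rf_add Lphi LXW (rf_Lcst Lphi M)).
  move=> w; rewrite /f /= lerD2r ge_max; apply/andP; split.
    by rewrite lerDl excess_ge0.
  rewrite -lerBlDl le_max; apply/orP; left.
  by have := ler_norm (- X w); rewrite normrN; lra.
have if_ : nu.-integrable setT (fun s => (f (x s) * `|y s|)%:E).
  apply/integrableP; split.
    by apply/measurable_EFinP; apply: measurable_funM => //; exact: measurableT_comp.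
  under eq_integral do rewrite /= ger0_norm ?mulr_ge0//.
  by rewrite (le_lt_trans (pos f mf f0 LfX))// ltry.
apply: (@le_trans _ _ (\int[nu]_s ((f (x s) * `|y s|)%:E - M%:E * `|y s|%:E))%E).
  apply: le_integral => //.
    by apply: integrableB => //; exact: integrableZl.
  move=> s _; rewrite -EFinM -EFinB lee_fin -mulrBl ler_wpM2r// /f addrK.
  by rewrite le_max lexx.
rewrite integralB//; last exact: integrableZl.
rewrite integralZl// y1 mule1.
apply: le_trans (leeB (pos f mf f0 LfX) (lexx _)) _.
by rewrite -EFinB lee_fin; lra.
Qed.

End dual_density_coupling.

(** * Dual densities that attain the risk *)

Section dual_density_existence.
Context (d : measure_display) (T : measurableType d) (R : realType).
Context (P : probability T R) (Pna : nonatomic P).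
Context (L : set (T -> R)) (phi : (T -> R) -> R).
Context (Lphi : risk_functional P L phi).
Local Notation prob := (prob P).
Implicit Types X Y : T -> R.

(** [l] is a linear functional on the functions of [k], given by its values on the
    indicators of the cells, and dominated there by [phi]. Its density with respect to
    the probabilities of the cells is shown to be a dual density. *)
Section step_density.
Context (I : finType) (k : T -> I) (mk : measurable_fibers k) (l : I -> R).
Context (l_le : forall y : I -> R, \sum_i l i * y i <= phi (y \o k)).
Local Notation p i := (prob (k @^-1` [set i])).

Lemma step_weight_ge0 i : 0 <= l i.
Proof.
have /= := l_le (fun j => - (j == i)%:R).
rewrite (bigD1 i)//= big1 ?addr0 => [|j /negbTE ->]; last by rewrite oppr0 mulr0.
rewrite eqxx mulrN1 => h; rewrite -oppr_le0 (le_trans h)//.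
rewrite -(rf_cst Lphi 0); apply: (rf_le Lphi).
- exact: (rf_Lfibers Lphi (fun j => - (j == i)%:R) mk).
- exact: (rf_Lcst Lphi).
- by move=> w; rewrite /= oppr_le0.
Qed.

Lemma sum_step_weight : \sum_i l i = 1.
Proof.
apply/eqP; rewrite eq_le; apply/andP; split.
  have := l_le (fun=> 1); rewrite (rf_cst Lphi 1).
  by under eq_bigr do rewrite mulr1.
have := l_le (fun=> - 1); rewrite (rf_cst Lphi (- 1)).
by under eq_bigr do rewrite mulrN1; rewrite sumrN lerN2.
Qed.

Lemma step_weight_null i : p i = 0 -> l i = 0.
Proof.
move=> pi0; apply/eqP; rewrite eq_le step_weight_ge0 andbT.
have /= := l_le (fun j => (j == i)%:R).
rewrite (bigD1 i)//= big1 ?addr0 => [|j /negbTE ->]; last by rewrite mulr0.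
rewrite eqxx mulr1 => h; rewrite (le_trans h)//.
rewrite -(rf_cst Lphi 0); apply: (rf_le_ae Lphi).
- exact: (rf_Lfibers Lphi (fun j => (j == i)%:R) mk).
- exact: (rf_Lcst Lphi).
exists (k @^-1` [set i]); split => //; first by rewrite probE// pi0.
by move=> w /=; case: eqVneq => // _; rewrite lexx.
Qed.

(* On null cells [l] vanishes, and so does [z], as division by 0 yields 0. *)
Let z i := l i / p i.

Lemma step_densityM i : z i * p i = l i.
Proof.
rewrite /z; have [p0|p0] := eqVneq (p i) 0; last by rewrite divfK.
by rewrite p0 mulr0 step_weight_null.
Qed.

Lemma step_density_ge0 i : 0 <= z i.
Proof. by rewrite divr_ge0 ?step_weight_ge0 ?prob_ge0. Qed.

(** Dilatation monotonicity: [phi] does not increase when [Y] is averaged over the cells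
    of [k]. Cut each cell into [n.+1] pieces of equal probability along the quantiles
    of [Y]. Shifting the pieces cyclically inside every cell at once does not change
    the law of the lower step function [low] of this partition, and the mean of the
    shifts is a function of [k], to which [l_le] applies. The error term is the gap
    between the upper and the lower step functions. *)
Lemma step_density_bounded_le (Y : T -> R) (B : R) n : measurable_fun setT Y ->
  (forall w, 0 <= Y w <= B) ->
  (\int[P]_w (Y w * z (k w))%:E <= (phi Y + B / n.+1%:R)%:E)%E.
Proof.
move=> mY Y0B.
have N0 : 0 < n.+1%:R :> R by rewrite ltr0n.
have LY : L Y.
  apply: (rf_bounded Lphi (K := B)) => // w.
  by have /andP[? ?] := Y0B w; rewrite ger0_norm.
have /choice[kt Hkt] i : exists kt : (T -> nat) * (nat -> R), [/\ measurable_fibers kt.1,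
    (forall x, k x = i -> (kt.1 x < n.+1)%N /\ kt.2 (kt.1 x) <= Y x <= kt.2 (kt.1 x).+1),
    (forall j, (j < n.+1)%N -> prob (k @^-1` [set i] `&` kt.1 @^-1` [set j]) = p i / n.+1%:R),
    kt.2 0%N = 0 & kt.2 n.+1 = B].
  have [||//|k1 [t1 H1]] := @quantile_equipartition_nat _ _ _ _ Pna n (k @^-1` [set i])
    Y 0 B (p i / n.+1%:R) (mk i) mY.
  - by move=> x _; exact: Y0B.
  - by rewrite divr_ge0// prob_ge0.
  - by rewrite mulrC divfK// gt_eqF.
  by exists (k1, t1).
pose t i := (kt i).2.
pose K w : I * 'I_n.+1 := (k w, inord ((kt (k w)).1 w)).
have mK : measurable_fibers K.
  apply: (measurable_fibers_glue (h := fun i w => inord ((kt i).1 w))) => // i.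
  by apply: measurable_fibers_comp_nat; case: (Hkt i).
have pK i j : prob (K @^-1` [set (i, j)]) = p i / n.+1%:R.
  have [_ ktN + _ _] := Hkt i => /(_ _ (ltn_ord j)) <-.
  congr prob; apply/seteqP; split => w; rewrite /K /=.
    move=> [kwi]; rewrite kwi => <-; split => //.
    by rewrite inordK//; case: (ktN w kwi).
  by move=> [-> ->]; rewrite inord_val.
have KY w : t (K w).1 (K w).2 <= Y w <= t (K w).1 (K w).2.+1.
  have [_ ktN _ _ _] := Hkt (k w); have [wN wt] := ktN w erefl.
  by rewrite /K /= inordK.
pose S_ i := \sum_(j < n.+1) t i j.
have telescope i : \sum_(j < n.+1) t i j.+1 = S_ i + B.
  have [_ _ _ t0 tN] := Hkt i.
  by rewrite /S_ [LHS]big_ord_recr [in RHS]big_ord_recl/= /t t0 tN add0r.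
(* The shift is stated through a function on ordinals, with addition modulo [n.+1]. *)
pose shift (j r : 'I_n.+1) : 'I_n.+1 := (j + r)%R.
have shiftI j : injective (shift j) by exact: addrI.
have shiftK r : cancel (shift ^~ (- r)%R) (shift ^~ r) by move=> j; exact: subrK.
have shiftNK r : cancel (shift ^~ r) (shift ^~ (- r)%R) by move=> j; exact: addrK.
pose low ij := t ij.1 (ij.2 : 'I_n.+1).
pose low_ (r : 'I_n.+1) : {ffun I * 'I_n.+1 -> R^o} := [ffun ij => low (ij.1, shift ij.2 r)].
have phi_low r : phi (low_ r \o K) = phi (low \o K).
  pose sh (ij : I * 'I_n.+1) := (ij.1, shift ij.2 r).
  have mshK : measurable_fibers (sh \o K) by exact: measurable_fibers_comp.
  rewrite -(rf_law_fibers Lphi low (k := sh \o K))//.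
    by congr phi; apply/funext => w; rewrite /= !ffunE.
  move=> [i j]; rewrite pK -(pK i (shift j (- r)%R)); congr prob.
  apply/seteqP; split => w; rewrite /sh /=.
    by move=> [<- <-]; rewrite shiftNK.
  by rewrite /K => -[-> ->]; rewrite shiftK.
have low_le : phi (low \o K) <= phi Y.
  apply: (rf_le Lphi) => //; first exact: (rf_Lfibers Lphi).
  by move=> w; case/andP: (KY w).
(* [S_ i / n.+1%:R] is the mean over all shifts [r] of [low_ r] on the cell [i]. *)
have mean : \sum_i l i * (S_ i / n.+1%:R) <= phi Y.
  apply: le_trans (l_le (fun i => S_ i / n.+1%:R)) _.
  have sub := rf_sublinear_fibers Lphi mK.
  rewrite (_ : _ \o k = (\sum_(r < n.+1) n.+1%:R^-1 *: low_ r : {ffun _ -> R^o}) \o K).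
    rewrite (le_trans (sublinear_sum _ _ sub))//.
    under eq_bigr do rewrite sub.2 ?invr_ge0 ?ler0n// phi_low.
    by rewrite sumr_const card_ord -[leLHS]mulr_natl mulrA divff ?mul1r// gt_eqF.
  apply/funext => w; rewrite /= sum_ffunE.
  under eq_bigr do rewrite !ffunE.
  rewrite -scaler_sumr /GRing.scale/= mulrC; congr (_ * _).
  by rewrite /S_ (reindex_inj (@shiftI (K w).2)).
rewrite (@le_trans _ _ (\int[P]_w (t (K w).1 (K w).2.+1 * z (K w).1)%:E)%E)//.
  apply: ge0_le_integral => //.
  - by move=> w _; rewrite lee_fin mulr_ge0 ?step_density_ge0//; case/andP: (Y0B w).
  - apply/measurable_EFinP; apply: measurable_funM => //.
    exact: (measurable_fun_fibers z mk).
  - apply/measurable_EFinP.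
    exact: (measurable_fun_fibers (fun ij : I * 'I_n.+1 => t ij.1 ij.2.+1 * z ij.1) mK).
  - move=> w _; rewrite lee_fin ler_wpM2r ?step_density_ge0//.
    by case/andP: (KY w).
rewrite (integral_fibers P (fun ij : I * 'I_n.+1 => t ij.1 ij.2.+1 * z ij.1) mK) lee_fin.
rewrite (eq_bigr (fun ij => (fun i (j : 'I_n.+1) => t i j.+1 * (l i / n.+1%:R)) ij.1 ij.2)); last first.
  by move=> [i j] _ /=; rewrite pK -step_densityM; ring.
rewrite -(pair_bigA _ (fun i (j : 'I_n.+1) => t i j.+1 * (l i / n.+1%:R)))/=.
under eq_bigr do rewrite -mulr_suml telescope.
rewrite (eq_bigr (fun i => l i * (S_ i / n.+1%:R) + l i * (B / n.+1%:R))); last first.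
  by move=> i _; ring.
by rewrite big_split/= -mulr_suml sum_step_weight mul1r lerD2r.
Qed.

Lemma step_dual_density : exists Z : {mfun T >-> R}, dual_density P L phi Z /\
  forall c : I -> R, (\int[P]_w (c (k w) * Z w)%:E = (\sum_i l i * c i)%:E)%E.
Proof.
have mZ : measurable_fun setT (z \o k) by exact: measurable_fun_fibers.
pose Z : {mfun T >-> R} := mfun_Sub (mem_set mZ).
have ZE c : (\int[P]_w (c (k w) * Z w)%:E = (\sum_i l i * c i)%:E)%E.
  rewrite (integral_fibers P (fun i => c i * z i) mk); congr EFin.
  by apply: eq_bigr => i _; rewrite -mulrA step_densityM mulrC.
exists Z; split => //; split.
- by move=> w; exact: step_density_ge0.
- exists (\sum_i z i) => w; rewrite /= (bigD1 (k w))//= lerDl sumr_ge0// => i _.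
  exact: step_density_ge0.
- rewrite -sum_step_weight; have := ZE (fun=> 1).
  under eq_integral do rewrite mul1r.
  by under eq_bigr do rewrite mulr1.
- move=> Y LY Y0; apply: (@integral_le_simple _ _ _ _ _ P id) => //.
  + exact: (rf_measurable Lphi LY).
  + by move=> w; exact: step_density_ge0.
  move=> n h b mh b0 bY /=.
  apply/lee_addgt0Pr => e e0; rewrite -EFinD.
  have mbh := measurable_fun_fibers b mh.
  pose B := \sum_i b i.
  have B0 : 0 <= B by rewrite sumr_ge0.
  have bB w : 0 <= (b \o h) w <= B.
    by rewrite /= b0/= /B (bigD1 (h w))//= lerDl sumr_ge0.
  apply: le_trans (step_density_bounded_le (Num.truncn (B / e)) mbh bB) _.
  rewrite lee_fin lerD//.
    by apply: (rf_le Lphi) => //; exact: (rf_Lfibers Lphi).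
  rewrite ler_pdivrMr ?ltr0n// mulrC -ler_pdivrMr//.
  exact/ltW/truncnS_gt.
Qed.

End step_density.

Lemma step_function_dual_density (I : finType) (k : T -> I) (c : I -> R) :
  measurable_fibers k -> exists Z : {mfun T >-> R}, dual_density P L phi Z /\
  (\int[P]_w (c (k w) * Z w)%:E = (phi (c \o k))%:E)%E.
Proof.
move=> mk.
have [l [l_le lc]] := finite_hahn_banach [ffun i => c i] (rf_sublinear_fibers Lphi mk).
have l_le' (y : I -> R) : \sum_i l i * y i <= phi (y \o k).
  have := l_le [ffun i => y i]; under eq_bigr do rewrite ffunE.
  by rewrite (_ : _ \o k = y \o k)//; apply/funext => w /=; rewrite ffunE.
have [Z [dZ ZE]] := step_dual_density mk l_le'.
exists Z; split => //; rewrite ZE; congr EFin.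
rewrite (_ : c \o k = [ffun i => c i] \o k); last by apply/funext => w /=; rewrite ffunE.
by rewrite -lc; apply: eq_bigr => i _; rewrite ffunE.
Qed.

(** Truncate [X] at the levels [- M] and [M], then round down to a multiple of [e]. *)
Lemma step_function_approximation X (e : R) : L X -> 0 < e ->
  exists n (k : T -> 'I_n.+1) (c : 'I_n.+1 -> R), measurable_fibers k /\
    exists W, [/\ L W, phi W <= 2 * e & forall w, `|X w - c (k w)| <= W w].
Proof.
move=> LX e0; have mX := rf_measurable Lphi LX.
have [M M0 tailM] := rf_tail Lphi LX e0.
pose cl w := Num.min (Num.max (X w) (- M)) M.
have cl_itv w : - M <= cl w <= M.
  by rewrite /cl ge_min lexx orbT le_min le_max lexx orbT /=; lra.
pose u w := (cl w + M) / e.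
have mu : measurable_fun setT u.
  apply: measurable_funM => //; apply: measurable_funD => //.
  by apply: measurable_minr => //; exact: measurable_maxr.
have u0M w : 0 <= u w <= 2 * M / e.
  have /andP[cl1 cl2] := cl_itv w; apply/andP; split.
    by apply: divr_ge0; [lra|exact: ltW].
  by rewrite ler_pM2r ?invr_gt0//; lra.
pose n := Num.truncn (2 * M / e).
pose k w : 'I_n.+1 := inord (Num.truncn (u w)).
have kE w : k w = Num.truncn (u w) :> nat.
  by rewrite inordK// ltnS; apply: le_truncn; case/andP: (u0M w).
have k_itv w : (k w)%:R <= u w < (k w).+1%:R.
  by rewrite kE truncn_itv//; case/andP: (u0M w).
have mk : measurable_fibers k.
  move=> i; rewrite [X in measurable X](_ : _ = u @^-1` `[i%:R, i.+1%:R[).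
    by rewrite -[X in measurable X]setTI; exact: mu.
  apply/seteqP; split => w /=; rewrite in_itv/=; first by move=> <-; exact: k_itv.
  move=> /truncn_def ui; apply: val_inj => /=; rewrite kE//.
exists n, k, (fun i => i%:R * e - M); split => //.
have Ltail := rf_Lexcess Lphi LX M0.
exists (fun w => excess X M w + e); split.
- exact: (rf_add Lphi Ltail (rf_Lcst Lphi e)).
- have := rf_subadditive Lphi Ltail (rf_Lcst Lphi e).
  by rewrite (rf_cst Lphi); lra.
move=> w.
have h1 : `|cl w - ((k w)%:R * e - M)| <= e.
  have := k_itv w; rewrite /u ler_pdivlMr// ltr_pdivrMr// -natr1 => /andP[a b].
  by rewrite ger0_norm; lra.
have h2 : `|X w - cl w| <= excess X M w.
  rewrite /excess /cl le_max.
  have [XM|XM] := leP (X w) (- M).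
    rewrite min_l; last by lra.
    by rewrite !ler0_norm; lra.
  have [XM'|XM'] := leP (X w) M; first by rewrite subrr normr0 lexx orbT.
  by rewrite !ger0_norm; lra.
rewrite (_ : X w - _ = (X w - cl w) + (cl w - ((k w)%:R * e - M))); last by ring.
by rewrite (le_trans (ler_normD _ _))// lerD.
Qed.
End dual_density_existence.

Section dual_density_attaining.
Context (d : measure_display) (T : measurableType d) (R : realType).
Context (P : probability T R) (Pna : nonatomic P).
Context (L : set (T -> R)) (phi : (T -> R) -> R).
Context (Lphi : risk_functional P L phi).

(** The pairing of [Z] with the difference of [X] and the step function is controlled by
    the risk of that difference, as [Z] is a dual density. *)
Lemma dual_density_attaining (X : T -> R) (e : R) : L X -> 0 < e ->
  exists Z : {mfun T >-> R}, dual_density P L phi Z /\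
    ((phi X - e)%:E <= \int[P]_w (X w * Z w)%:E)%E.
Proof.
move=> LX e0; have e4 : 0 < e / 4 by lra.
have [n [k [c [mk [W [LW phiW XW]]]]]] := step_function_approximation Lphi LX e4.
have [Z [dZ ZE]] := step_function_dual_density Pna Lphi c mk.
exists Z; split => //.
have LS := rf_Lfibers Lphi c mk.
pose D w := c (k w) - X w.
have LD : L D.
  have := rf_add Lphi LS (rf_scale Lphi (- 1) LX).
  by under eq_fun do rewrite mulN1r.
have phiD : phi D <= phi W.
  apply: (rf_le Lphi) => // w; apply: le_trans (XW w).
  by rewrite distrC; exact: ler_norm.
have phiS : phi X <= phi (c \o k) + phi W.
  apply: le_trans (rf_subadditive Lphi LS LW).
  apply: (rf_le Lphi) => //; first exact: (rf_add Lphi LS LW).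
  by move=> w /=; have := ler_norm (X w - c (k w)); have := XW w; lra.
have mX := rf_measurable Lphi LX; have mD := rf_measurable Lphi LD.
have mZ : measurable_fun setT Z by [].
have [iXZ _] := dual_density_coupling Pna Lphi dZ LX mX mZ (fun _ _ => erefl) (fun _ _ => erefl).
have [iDZ DZ] := dual_density_coupling Pna Lphi dZ LD mD mZ (fun _ _ => erefl) (fun _ _ => erefl).
have : (\int[P]_w (c (k w) * Z w)%:E =
    \int[P]_w (X w * Z w)%:E + \int[P]_w (D w * Z w)%:E)%E.
  rewrite -integralD//; apply: eq_integral => w _.
  by rewrite -EFinD /D -mulrDl subrKC.
rewrite ZE; have := integrable_fin_num measurableT iXZ.
have := integrable_fin_num measurableT iDZ.
move: DZ; case: (\int[P]_w (D w * Z w)%:E)%E => [a|//|//].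
case: (\int[P]_w (X w * Z w)%:E)%E => [b|//|//].
by rewrite lee_fin => ha _ _ []; rewrite lee_fin; lra.
Qed.

End dual_density_attaining.

(** * Lebesgue spaces of a probability *)

Section Lfun_facts.
Context (d : measure_display) (T : measurableType d) (R : realType).
Context (P : probability T R).
Implicit Types f g : T -> R.

Lemma Lfun_measurable (p : \bar R) f : f \in Lfun P p -> measurable_fun setT f.
Proof. by move=> /sub_Lfun_mfun/set_mem. Qed.

Lemma Lfun_dominated (p : \bar R) f g : (1 <= p)%E -> g \in Lfun P p ->
  measurable_fun setT f -> (forall w, `|f w| <= `|g w|) -> f \in Lfun P p.
Proof.
move=> p1 gL mf fg; have mg := Lfun_measurable gL.
apply/andP; split; apply/mem_set => //=.
move: gL => /sub_Lfun_finLfun/set_mem/=; apply: le_lt_trans.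
rewrite unlock; case: p p1 => [r|_|//].
  rewrite lee_fin => r1; have r0 : 0 <= r by rewrite (le_trans ler01).
  have mpow (h : T -> R) : measurable_fun setT h ->
      measurable_fun setT (fun w => `|(EFin \o h) w| `^ r)%E.
    move=> mh; apply/measurable_EFinP.
    apply: (measurableT_comp (measurable_powR _)) => //; exact: measurableT_comp.
  apply: gt0_ler_poweR; rewrite ?invr_ge0 ?in_itv/= ?leey ?andbT ?integral_ge0//;
    try by move=> w _; exact: poweR_ge0.
  apply: ge0_le_integral => //; [exact: mpow|exact: mpow|move=> w _].
  by rewrite lee_fin ge0_ler_powR ?nnegrE.
rewrite /= probability_setT lte01; apply: le_ess_sup.
by apply: aeW => w /=; rewrite lee_fin.
Qed.

Lemma Lfun_powR_lty (r : R) f : 1 <= r -> measurable_fun setT f ->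
  (\int[P]_w (`|f w| `^ r)%:E < +oo)%E -> f \in Lfun P r%:E.
Proof.
move=> r1 mf foo; apply/andP; split; apply/mem_set => //=.
by rewrite /finite_norm unlock; exact: poweR_lty.
Qed.

Lemma Lfun_bounded (p : \bar R) f K : (1 <= p)%E -> measurable_fun setT f ->
  (forall w, `|f w| <= K) -> f \in Lfun P p.
Proof.
move=> p1 mf fK; apply: (Lfun_dominated p1 (Lfun_cst_probability P p1 K)) => // w.
exact: le_trans (fK w) (ler_norm _).
Qed.

Lemma Lfun_excess (p : \bar R) f M : (1 <= p)%E -> f \in Lfun P p -> 0 <= M ->
  excess f M \in Lfun P p.
Proof.
move=> p1 fL M0; have mf := measurable_excess M (Lfun_measurable fL).
apply: (Lfun_dominated p1 fL mf) => w.
by rewrite ger0_norm ?excess_ge0// excess_le.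
Qed.

End Lfun_facts.

(** * Coherent risk measures on Lebesgue spaces *)

Section coherent_theory.
Context (R : realType) (p : \bar R) (p1 : (1 <= p)%E).
Context (d : measure_display) (T : measurableType d) (P : probability T R).
Context (rho : LfunType P p1 -> R) (rho_coh : coherent rho).
Implicit Types X Y : LfunType P p1.

Lemma coherentZ (a : R) X : 0 <= a -> rho (a *: X) = a * rho X.
Proof. by case: rho_coh => _ h _ _; exact: h. Qed.

Lemma coherent_le X Y : (\forall w \ae P, X w <= Y w) -> rho X <= rho Y.
Proof. by case: rho_coh => _ _ h _; exact: h. Qed.

Lemma coherentD X Y : rho (X + Y) <= rho X + rho Y.
Proof.
case: rho_coh => _ _ _ cvx.
have h : 0 <= (2^-1 : R) <= 1 by lra.
have := cvx X Y _ h; rewrite (_ : 1 - 2^-1 = 2^-1); last by lra.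
by rewrite -scalerDr coherentZ; lra.
Qed.

Lemma coherent_cst (a : R) : rho (Lconst P p1 a) = a.
Proof.
case: rho_coh => tr _ _ _.
by rewrite -[Lconst _ _ _]add0r tr -(scale0r 0) coherentZ// mul0r add0r.
Qed.

Definition Lfun_ext (f : T -> R) : LfunType P p1 := insubd 0 f.

Lemma Lfun_extE (f : T -> R) : f \in Lfun P p -> Lfun_ext f = f :> (T -> R).
Proof. by move=> fL; exact: insubdK. Qed.

Lemma coherent_le_ext (f g : T -> R) : f \in Lfun P p -> g \in Lfun P p ->
  (\forall w \ae P, f w <= g w) -> rho (Lfun_ext f) <= rho (Lfun_ext g).
Proof.
by move=> fL gL fg; apply: coherent_le; rewrite !Lfun_extE.
Qed.

End coherent_theory.

Section finite_exponent.
Context (R : realType) (r : R) (p1 : (1 <= r%:E)%E).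
Context (d : measure_display) (T : measurableType d) (P : probability T R).
Context (rho : LfunType P p1 -> R) (rho_coh : coherent rho).

(** Automatic continuity: a real-valued monotone sublinear functional on a Banach
    lattice is bounded. Otherwise there are [Y k >= 0] in the unit ball with
    [rho (Y k) > 4 ^+ k]. The function [S], the [r]-th root of the sum of the
    [2^-1 ^+ k * Y k `^ r], is in the space and dominates every [2^-1 ^+ k *: Y k], which
    makes [rho S] larger than every [2 ^+ k]. Summing powers rather than the functions
    themselves spares the triangle inequality. *)
Lemma coherent_bounded_unit_ball : exists2 C : R, 0 <= C &
  forall Y : LfunType P p1, (forall w, 0 <= Y w) ->
    (\int[P]_w (Y w `^ r)%:E <= 1)%E -> rho Y <= C.
Proof.
have r1 : 1 <= r by rewrite -lee_fin.
have r0 : 0 < r by rewrite (lt_le_trans ltr01).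
have rN0 : r != 0 by rewrite gt_eqF.
apply: contrapT => nC.
have /choice[Y HY] k : exists Y : LfunType P p1, [/\ (forall w, 0 <= Y w),
    (\int[P]_w (Y w `^ r)%:E <= 1)%E & 4 ^+ k < rho Y].
  apply: contrapT => nY; apply: nC; exists (4 ^+ k) => // Y Y0 Y1.
  by rewrite leNgt; apply/negP => h; apply: nY; exists Y.
pose u k w : \bar R := (2^-1 ^+ k * Y k w `^ r)%:E.
have mY k : measurable_fun setT (Y k) by exact: Lfun_measurable (LfunP (Y k)).
have mYr k : measurable_fun setT (fun w => Y k w `^ r).
  exact: measurableT_comp (measurable_powR _) (mY k).
have mu k : measurable_fun setT (u k).
  by apply/measurable_EFinP; apply: measurable_funM.
have u0 k w : (0 <= u k w)%E.
  by rewrite lee_fin mulr_ge0 ?powR_ge0// exprn_ge0//; lra.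
pose G w := (\sum_(k <oo) u k w)%E.
have mG : measurable_fun setT G by apply: ge0_emeasurable_sum.
have G0 w : (0 <= G w)%E by apply: nneseries_ge0 => k _ _; exact: u0.
have iG : (\int[P]_w G w <= 2%:E)%E.
  rewrite integral_nneseries//.
  have c : (\sum_(0 <= k < n) (2^-1 ^+ k)%:E)%E @[n --> \oo] --> (2%:E : \bar R).
    under eq_fun do rewrite sumEFin.
    have -> : 2%:E = (1 / (1 - 2^-1) : R)%:E :> \bar R 
      by congr EFin; rewrite [X in _ / X](_ : _ = 2^-1) ?invrK ?mul1r//; lra.
    apply: cvg_EFin; first by apply: nearW.
    have := @cvg_geometric_series R 1 2^-1.
    rewrite /geometric /series/=; under eq_fun do under eq_bigr do rewrite mul1r.
    by apply; rewrite ger0_norm; lra.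
  rewrite -(cvg_lim _ c)//; apply: lee_nneseries => k _; first by move=> _; exact: integral_ge0.
  rewrite /u; under eq_integral do rewrite EFinM.
  rewrite ge0_integralZl_EFin//.
  - rewrite -[leRHS]mule1; apply: lee_wpmul2l; first by rewrite lee_fin exprn_ge0//; lra.
    by case: (HY k).
  - by move=> w _; rewrite lee_fin powR_ge0.
  - exact/measurable_EFinP.
have Gfin : {ae P, forall w, setT w -> G w \is a fin_num}.
  apply: integrable_ae => //; apply/integrableP; split => //.
  under eq_integral do rewrite gee0_abs//.
  exact: le_lt_trans iG (ltry _).
pose S w := fine (G w) `^ r^-1.
have S0 w : 0 <= S w by exact: powR_ge0.
have mS : measurable_fun setT S.
  by apply: (measurableT_comp (measurable_powR _)) => //; exact: measurableT_comp.
have SL : S \in Lfun P r%:E.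
  apply: Lfun_powR_lty => //; apply: le_lt_trans (le_lt_trans iG (ltry _)).
  apply: ge0_le_integral => //.
  - apply/measurable_EFinP; apply: (measurableT_comp (measurable_powR _)) => //.
    exact: measurableT_comp.
  - move=> w _; rewrite (ger0_norm (S0 w)) -powRrM mulVf ?gt_eqF// powRr1 ?fine_ge0//.
    by have := G0 w; case: (G w) => [s _| |//]; rewrite ?leey ?lexx.
have YS k : 2^-1 ^+ k * rho (Y k) <= rho (Lfun_ext p1 P S).
  have k0 : 0 <= (2^-1 : R) ^+ k by rewrite exprn_ge0//; lra.
  rewrite -(coherentZ rho_coh)//; apply: (coherent_le rho_coh).
  apply: filterS Gfin => w /(_ I) Gw.
  rewrite (Lfun_extE p1 SL) [leLHS](_ : _ = 2^-1 ^+ k * Y k w)//.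
  have [Y0 _ _] := HY k.
  rewrite [leLHS](_ : _ = ((2^-1 ^+ k * Y k w) `^ r) `^ r^-1); last first.
    by rewrite -powRrM mulfV// powRr1// mulr_ge0.
  apply: ge0_ler_powR; rewrite ?nnegrE ?invr_ge0 ?powR_ge0 ?fine_ge0 ?(ltW r0)//.
  rewrite -lee_fin fineK//; apply: (@le_trans _ _ (u k w)).
    rewrite /u lee_fin powRM// ler_wpM2r ?powR_ge0//.
    by apply: ge1r_powR => //; rewrite exprn_gt0 ?exprn_ile1//; lra.
  have := @nneseries_lim_ge _ (u ^~ w) xpredT 0 k.+1 (fun n _ _ => u0 n w).
  apply: le_trans; rewrite big_nat_recr//= leeDr//.
  by apply: sume_ge0 => i _; exact: u0.
pose a := rho (Lfun_ext p1 P S).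
have [n an] : exists n, a < n%:R by exists (Num.truncn a).+1; exact: truncnS_gt.
have [_ _ hY] := HY n.
have := YS n; apply/negP; rewrite -ltNge -/a (lt_le_trans an)//.
apply: (@le_trans _ _ (2 ^+ n)); first by rewrite -natrX ler_nat ltnW// ltn_expl.
have -> : 2 ^+ n = 2^-1 ^+ n * 4 ^+ n :> R.
  by rewrite -exprMn; congr (_ ^+ _); lra.
have k0 : 0 <= 2^-1 ^+ n :> R by rewrite exprn_ge0//; lra.
exact: ler_wpM2l k0 _ _ (ltW hY).
Qed.

End finite_exponent.

Section finite_exponent_tail.
Context (R : realType) (r : R) (p1 : (1 <= r%:E)%E).
Context (d : measure_display) (T : measurableType d) (P : probability T R).
Context (rho : LfunType P p1 -> R) (rho_coh : coherent rho).
Local Notation phi f := (rho (Lfun_ext p1 P f)).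
Implicit Types f : T -> R.

(** Stated with a majorant [c] of the norm in place of the norm, to include functions of
    norm 0. *)
Lemma coherent_Lnorm_bound : exists2 C : R, 0 <= C &
  forall f (c : R), f \in Lfun P r%:E -> (forall w, 0 <= f w) -> 0 < c ->
    (\int[P]_w (f w `^ r)%:E <= (c `^ r)%:E)%E -> phi f <= C * c.
Proof.
have r1 : 1 <= r by rewrite -lee_fin.
have r0 : 0 < r by rewrite (lt_le_trans ltr01).
have [C C0 HC] := coherent_bounded_unit_ball rho_coh.
exists C => // f c fL f0 c0 fc.
have cV0 : 0 <= c^-1 by rewrite invr_ge0 ltW.
have YE w : (c^-1 *: Lfun_ext p1 P f : LfunType P p1) w = c^-1 * f w.
  by rewrite -[in RHS](Lfun_extE p1 fL).
have := HC (c^-1 *: Lfun_ext p1 P f); rewrite (coherentZ rho_coh)//.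
rewrite mulrC ler_pdivrMr//; apply => [w|]; first by rewrite YE mulr_ge0.
under eq_integral do rewrite YE powRM// EFinM.
rewrite ge0_integralZl_EFin ?powR_ge0//; last 2 first.
- by move=> w _; rewrite lee_fin powR_ge0.
- apply/measurable_EFinP; apply: measurableT_comp (measurable_powR _) _.
  exact: Lfun_measurable fL.
apply: le_trans (lee_wpmul2l _ fc) _; first by rewrite lee_fin powR_ge0.
by rewrite -EFinM -powRM ?(ltW c0)// mulVf ?powR1// gt_eqF.
Qed.

Lemma coherent_tail_finite f (e : R) : f \in Lfun P r%:E -> 0 < e ->
  exists2 M : R, 0 <= M & phi (excess f M) <= e.
Proof.
move=> fL e0.
have r1 : 1 <= r by rewrite -lee_fin.
have r0 : 0 < r by rewrite (lt_le_trans ltr01).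
have mf := Lfun_measurable fL.
have [C C0 HC] := coherent_Lnorm_bound.
pose W n := excess f n%:R.
have W0 n w : 0 <= W n w by exact: excess_ge0.
have Wf n w : W n w <= `|f w| by exact: excess_le.
have mW n : measurable_fun setT (W n) by exact: measurable_excess.
have WL n : W n \in Lfun P r%:E by exact: Lfun_excess.
have mWr n : measurable_fun setT (fun w => (W n w `^ r)%:E).
  by apply/measurable_EFinP; exact: (measurableT_comp (measurable_powR _)).
have cvgW : {ae P, forall w, setT w ->
    (W n w `^ r)%:E @[n --> \oo] --> (cst 0 w : \bar R)%E}.
  apply: aeW => w _; apply: cvg_near_cst; near=> n.
  rewrite /W /excess max_r ?powR0 ?gt_eqF// subr_le0 (le_trans (ltW (truncnS_gt _)))//.
  by rewrite ler_nat; near: n; exact: nbhs_infty_ge.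
have domW : {ae P, forall w n, setT w -> (`|(W n w `^ r)%:E| <= (`|f w| `^ r)%:E)%E}.
  apply: aeW => w n _; rewrite /= ger0_norm ?powR_ge0// lee_fin.
  by rewrite ge0_ler_powR ?nnegrE ?(ltW r0).
have [_ _] := dominated_convergence measurableT mWr (measurable_cst _) cvgW
  (Lfun_integrable r1 fL) domW.
rewrite integral0 => cW.
have c0 : 0 < e / (C + 1) by rewrite divr_gt0// ltr_wpDl.
have [n hn] : exists n, (\int[P]_w (W n w `^ r)%:E <= ((e / (C + 1)) `^ r)%:E)%E.
  apply: contrapT => nW; have : (((e / (C + 1)) `^ r)%:E <= 0)%E.
    apply: (cvge_to_ge cW); apply: nearW => n /=; apply/ltW.
    by rewrite ltNge; apply/negP => h; apply: nW; exists n.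
  by rewrite lee_fin leNgt powR_gt0.
exists n%:R => //; apply: (@le_trans _ _ (C * (e / (C + 1)))).
  exact: HC (WL n) (W0 n) c0 hn.
by rewrite mulrCA ger_pMr// ler_pdivrMr; lra.
Unshelve. all: by end_near. Qed.

End finite_exponent_tail.

Section coherent_risk_functional.
Context (R : realType) (p : \bar R) (p1 : (1 <= p)%E).
Context (d : measure_display) (T : measurableType d) (P : probability T R).
Context (rho : LfunType P p1 -> R).
Context (rho_law : law_invariant rho) (rho_coh : coherent rho).
Local Notation phi f := (rho (Lfun_ext p1 P f)).
Implicit Types f : T -> R.

Lemma coherent_tail f (e : R) : f \in Lfun P p -> 0 < e ->
  exists2 M : R, 0 <= M & phi (excess f M) <= e.
Proof.
case: p p1 rho rho_coh => [r r1|y1|//] rho' coh'; first exact: coherent_tail_finite.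
move=> fL e0; have mf := Lfun_measurable fL.
have := fL => /sub_Lfun_finLfun/set_mem/=.
rewrite /finite_norm unlock/= probability_setT lte01 => /ess_supr_bounded[K fK].
pose M := Num.max K 0.
have M0 : 0 <= M by rewrite le_max lexx orbT.
exists M => //.
apply: (@le_trans _ _ (rho' (Lfun_ext y1 P (cst 0)))).
  apply: (coherent_le_ext coh').
  - exact: Lfun_excess.
  - exact: Lfun_cst_probability.
  - apply: filterS fK => w fK; rewrite /excess ge_max lexx andbT subr_le0.
    by rewrite le_max; apply/orP; left.
rewrite (_ : Lfun_ext _ _ _ = Lconst P y1 0) ?(coherent_cst coh') ?(ltW e0)//.
apply/LfuneqP => w; rewrite Lfun_extE//; exact: Lfun_cst_probability.
Qed.

(** Elements of the space are compared through their underlying functions, as [Lfun_ext]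
    is compatible with sums and multiples on the space. *)
Lemma coherent_risk_functional :
  risk_functional P [set f | f \in Lfun P p] (fun f => phi f).
Proof.
have extD f g : f \in Lfun P p -> g \in Lfun P p ->
    (fun w => f w + g w) \in Lfun P p /\
    Lfun_ext p1 P (fun w => f w + g w) = Lfun_ext p1 P f + Lfun_ext p1 P g.
  move=> fL gL; have E : (fun w => f w + g w) = (Lfun_ext p1 P f + Lfun_ext p1 P g : LfunType P p1).
    by apply/funext => w; rewrite -[in LHS](Lfun_extE p1 fL) -[in LHS](Lfun_extE p1 gL).
  have fgL : (fun w => f w + g w) \in Lfun P p by rewrite E; exact: LfunP.
  by split => //; apply/LfuneqP => w; rewrite Lfun_extE//; exact: (congr1 (fun h => h w) E).
have extZ a f : f \in Lfun P p -> (fun w => a * f w) \in Lfun P p /\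
    Lfun_ext p1 P (fun w => a * f w) = a *: Lfun_ext p1 P f.
  move=> fL; have E : (fun w => a * f w) = (a *: Lfun_ext p1 P f : LfunType P p1).
    by apply/funext => w; rewrite -[in LHS](Lfun_extE p1 fL).
  have afL : (fun w => a * f w) \in Lfun P p by rewrite E; exact: LfunP.
  by split => //; apply/LfuneqP => w; rewrite Lfun_extE//; exact: (congr1 (fun h => h w) E).
split => /=.
- by move=> f; exact: Lfun_measurable.
- by move=> f K; exact: Lfun_bounded.
- by move=> f g gL; exact: Lfun_dominated.
- by move=> f g fL gL; case: (extD f g fL gL).
- by move=> a f fL; case: (extZ a f fL).
- by move=> f g; exact: coherent_le_ext.
- by move=> f g fL gL; case: (extD f g fL gL) => _ ->; exact: coherentD.
- by move=> a f a0 fL; case: (extZ a f fL) => _ ->; exact: coherentZ.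
- move=> a; rewrite (_ : Lfun_ext _ _ _ = Lconst P p1 a) ?(coherent_cst rho_coh)//.
  by apply/LfuneqP => w; rewrite Lfun_extE//; exact: Lfun_cst_probability.
- move=> f g fL gL fg; apply: rho_law => A mA.
  by have := fg A mA; rewrite -[in LHS](Lfun_extE p1 fL) -[in RHS](Lfun_extE p1 gL).
- by move=> f e fL e0; exact: coherent_tail.
Qed.

End coherent_risk_functional.

(** * Laws of dual densities *)

Section dual_law.
Context (R : realType) (d : measure_display) (T : measurableType d).
Context (P : probability T R) (L : set (T -> R)) (phi : (T -> R) -> R).
Implicit Types (Z : {mfun T >-> R}) (m : probability R R).

Lemma dual_law_support Z m : dual_density P L phi Z -> same_measure m (distribution P Z) ->
  measure_supp m `<=` [set y | 0 <= y].
Proof.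
move=> [Z0 _ _ _] mZ y /= suppy; rewrite leNgt; apply/negP => y0.
have o : open [set u : R | u < 0] by exact: open_lt.
have := suppy _ o y0; rewrite mZ; last exact: open_measurable.
rewrite /distribution/= /pushforward (_ : Z @^-1` _ = set0) ?measure0 ?ltxx//.
by rewrite -subset0 => w /=; rewrite ltNge Z0.
Qed.

Lemma dual_law_mean Z m : dual_density P L phi Z -> same_measure m (distribution P Z) ->
  (\int[m]_y y%:E = 1)%E.
Proof.
move=> [Z0 _ Z1 _] mZ.
rewrite (eq_measure_integral (distribution P Z)); last first.
  by move=> A mA _; exact: mZ.
rewrite integral_distribution//.
apply/integrableP; split; first exact/measurable_EFinP.
rewrite (_ : (\int[P]_x _)%E = 1%E) ?ltry// -Z1.
by apply: eq_integral => w _; rewrite /= ger0_norm.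
Qed.

End dual_law.

Section dual_density_moment.
Context (R : realType) (p : \bar R) (p1 : (1 <= p)%E).
Context (d : measure_display) (T : measurableType d) (P : probability T R).
Context (rho : LfunType P p1 -> R) (rho_coh : coherent rho).
Local Notation phi := (fun f => rho (Lfun_ext p1 P f)).
Local Notation dual := (dual_density P [set f | f \in Lfun P p] phi).
Implicit Types (Z : {mfun T >-> R}) (m : probability R R).

(** Duality of norms: [Z] is tested against its own power [Z `^ (q - 1)], whose [r]-th
    power is [Z `^ q], which gives [A <= C * A `^ r^-1] with [A] the [q]-th moment. For
    [r = 1], the test functions are the indicators of [Z > c]. *)
Lemma dual_law_moment : exists C : R, forall Z m, dual Z ->
  same_measure m (distribution P Z) ->
  (moment (hoelder_conjugate p) m <= C%:E)%E.
Proof.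
have intE Z m (g : R -> \bar R) : same_measure m (distribution P Z) ->
    measurable_fun setT g -> (forall u, 0 <= g u)%E ->
    (\int[m]_y g y = \int[P]_w g (Z w))%E.
  by move=> mZ mg g0; exact: (@ge0_integral_same_law _ _ _ _ _ P m id Z g).
case: p p1 rho rho_coh => [r r1|y1|//] rho' coh'; last first.
  exists 1 => Z m [Z0 _ Z1 _] mZ; rewrite hoelder_conjugatey /moment/= Lnorm1.
  rewrite (intE Z) => //.
    rewrite -Z1 le_eqVlt; apply/orP; left; apply/eqP.
    by apply: eq_integral => w _; rewrite /= ger0_norm.
  by apply/measurable_EFinP; exact: normr_measurable.
have [C C0 HC] := coherent_Lnorm_bound coh'.
exists C => Z m dZ mZ; have [Z0 [K ZK] Z1 leZ] := dZ.
have mZf : measurable_fun setT Z by [].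
have r1' : 1 <= r by rewrite -lee_fin.
have [r_eq1|rn1] := eqVneq r 1.
  subst r; rewrite hoelder_conjugate1 /moment eqxx.
  apply: ge_ereal_sup => _ [y suppy <-]; rewrite lee_fin.
  have y0 : 0 <= y by exact: (dual_law_support dZ mZ).
  rewrite ger0_norm// leNgt; apply/negP => Cy.
  pose c := (C + y) / 2.
  have Cc : C < c by rewrite /c; lra.
  have o : open [set u : R | c < u] by exact: open_gt.
  have mo := open_measurable o.
  pose A := Z @^-1` [set u | c < u].
  have mA : measurable A by rewrite -[X in measurable X]setTI; exact: mZf.
  have PA : 0 < prob P A.
    by rewrite -lte_fin -probE// -[P A]/(distribution P Z _) -mZ//; apply: suppy => //=; rewrite /c; lra.
  have mI : measurable_fun setT (\1_A : T -> R) by [].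
  have IL : \1_A \in Lfun P (1%R)%:E.
    apply: (@Lfun_bounded _ _ _ _ _ _ 1) => // w.
    by rewrite indicE; case: (_ \in _); rewrite ?normr1 ?normr0.
  have := leZ (\1_A) IL (fun w => ler0n _ _); apply/negP; rewrite -ltNge.
  have PAE : (P A = \int[P]_w (\1_A w)%:E)%E by rewrite integral_indic// setIT.
  have mIE : measurable_fun setT (fun w => (\1_A w)%:E : \bar R).
    exact/measurable_EFinP.
  apply: (@le_lt_trans _ _ (C * prob P A)%:E).
    rewrite lee_fin; apply: HC => //.
    rewrite powRr1 ?prob_ge0// -probE// PAE.
    by under eq_integral do rewrite powRr1//.
  apply: (@lt_le_trans _ _ (c * prob P A)%:E); first by rewrite lte_fin ltr_pM2r.
  rewrite EFinM -probE// PAE -ge0_integralZl_EFin//; last first.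
    by rewrite (le_trans C0 (ltW Cc)).
  apply: ge0_le_integral => //.
  - by move=> w _; rewrite -EFinM lee_fin mulr_ge0// (le_trans C0 (ltW Cc)).
  - exact: measurable_funeM.
  - by apply/measurable_EFinP; exact: measurable_funM.
  - move=> w _; rewrite -EFinM lee_fin indicE; case: (boolP (w \in A)) => [/set_mem/= cw|_].
      by rewrite mulr1 mul1r ltW.
    by rewrite mulr0 mul0r.
have r_gt1 : 1 < r by rewrite lt_neqAle eq_sym rn1.
have r0 : 0 < r by rewrite (lt_trans ltr01).
pose q := r / (r - 1).
have rB0 : 0 < r - 1 by rewrite subr_gt0.
have qE : hoelder_conjugate r%:E = q%:E.
  rewrite /hoelder_conjugate/= gt_eqF// -EFinB inver subr_eq0.
  by rewrite (negbTE rn1) -EFinM.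
rewrite qE.
have q0 : 0 < q by rewrite divr_gt0.
have q1 : q - 1 = (r - 1)^-1 by rewrite /q; field; rewrite gt_eqF.
have q1r : (q - 1) * r = q by rewrite q1 /q mulrC.
have qV : q^-1 = 1 - r^-1 by rewrite /q; field; rewrite !gt_eqF.
pose f w := Z w `^ (q - 1).
have mf : measurable_fun setT f by exact: (measurableT_comp (measurable_powR _)).
have q1_ge0 : 0 <= q - 1 by rewrite q1 invr_ge0 ltW.
have fL : f \in Lfun P r%:E.
  apply: (@Lfun_bounded _ _ _ _ _ _ (K `^ (q - 1))) => // w.
  rewrite ger0_norm ?powR_ge0// ge0_ler_powR ?nnegrE//.
  exact: le_trans (Z0 w) (ZK w).
have f0 w : 0 <= f w by exact: powR_ge0.
have mZq : measurable_fun setT (fun w => Z w `^ q).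
  exact: (measurableT_comp (measurable_powR _)).
have momentE : (moment q%:E m = (\int[P]_w (Z w `^ q)%:E) `^ q^-1)%E.
  rewrite /moment/= unlock; congr (_ `^ _)%E.
  rewrite (intE Z m (fun u => (`|u| `^ q)%:E))//.
  - by apply: eq_integral => w _; rewrite ger0_norm.
  - by apply/measurable_EFinP; exact: (measurableT_comp (measurable_powR _)).
have fr : (\int[P]_w (f w `^ r)%:E = \int[P]_w (Z w `^ q)%:E)%E.
  by apply: eq_integral => w _; rewrite /f -powRrM q1r.
have fZ : (\int[P]_w (f w * Z w)%:E = \int[P]_w (Z w `^ q)%:E)%E.
  by apply: eq_integral => w _; rewrite /f mulrC mulr_powRB1.
have fZphi := leZ f fL f0; move: fZphi; rewrite fZ {}momentE.
have : (0 <= \int[P]_w (Z w `^ q)%:E)%E.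
  by apply: integral_ge0 => w _; rewrite lee_fin powR_ge0.
move: fr; case: (\int[P]_w (Z w `^ q)%:E)%E => [A frA|//|//].
rewrite poweR_EFin !lee_fin le_eqVlt => /predU1P[<- _|A0 Af].
  by rewrite powR0// gt_eqF// invr_gt0.
have c0 : 0 < A `^ r^-1 by exact: powR_gt0.
have := HC f (A `^ r^-1) fL f0 c0.
rewrite -powRrM mulVf ?gt_eqF// powRr1 ?(ltW A0)// frA lexx => /(_ isT) h.
rewrite qV powRB ?powRr1 ?(ltW A0)//; last by apply/implyP => _; rewrite gt_eqF.
by rewrite ler_pdivrMr// (le_trans Af).
Qed.

End dual_density_moment.

(** * The dual representation *)

Theorem theorem4p3 (R : realType) (p : \bar R) (p1 : (1 <= p)%E)
    (d : measure_display) (T : measurableType d) (P : probability T R)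
    (Pna : nonatomic P) (rho : LfunType P p1 -> R)
    (rho_law : law_invariant rho) (rho_coh : coherent rho)
    (rho_fatou : p = +oo%E -> fatou_property rho) :
  exists D : set (probability R R),
    [/\ D `<=` finite_moment (hoelder_conjugate p),
        (ereal_sup [set moment (hoelder_conjugate p) r | r in D] < +oo)%E,
        (forall r, D r -> measure_supp r `<=` [set y | 0 <= y]),
        (forall r : probability R R, D r -> (\int[r]_y y%:E = 1)%E) &
        forall X : LfunType P p1, (rho X)%:E = chi D (distribution P X)].
Proof.
pose L := [set f : T -> R | f \in Lfun P p].
pose phi f := rho (Lfun_ext p1 P f).
have Lphi : risk_functional P L phi by exact: coherent_risk_functional.
have [C HC] := dual_law_moment rho_coh.
exists [set m | exists2 Z, dual_density P L phi Z & same_measure m (distribution P Z)].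
split.
- by move=> m [Z dZ mZ]; rewrite /finite_moment/= (le_lt_trans (HC _ _ dZ mZ))// ltry.
- apply: (@le_lt_trans _ _ C%:E); last exact: ltry.
  by apply: ge_ereal_sup => _ [m [Z dZ mZ] <-]; exact: HC dZ mZ.
- by move=> m [Z dZ mZ]; exact: dual_law_support dZ mZ.
- by move=> m [Z dZ mZ]; exact: dual_law_mean dZ mZ.
move=> X; have LX : L X by exact: LfunP.
have mX : measurable_fun setT X by [].
have phiX : phi X = rho X by congr rho; apply/LfuneqP => w; rewrite Lfun_extE.
apply/eqP; rewrite -phiX eq_le; apply/andP; split; last first.
  apply: ge_ereal_sup => _ [nu [nuX [r [Z dZ rZ] nur]] <-].
  apply: (dual_density_coupling Pna Lphi dZ LX _ _ _ _).2 => //.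
  by move=> A mA; exact: etrans (nur A mA) (rZ A mA).
apply/lee_addgt0Pr => e e0; have [Z [dZ XZ]] := dual_density_attaining Pna Lphi LX e0.
have mZ : measurable_fun setT Z by [].
pose XZm : {mfun T >-> (R * R)%type} := mfun_Sub (mem_set (measurable_fun_pair mX mZ)).
rewrite -leeBlDr//; apply: (le_trans XZ); apply: ereal_sup_ubound.
exists (distribution P XZm : probability _ _).
  by split => //; exists (distribution P Z : probability _ _) => //; exists Z.
have [iXZ _] := dual_density_coupling Pna Lphi dZ LX mX mZ
  (fun _ _ => erefl) (fun _ _ => erefl).
rewrite integral_distribution//.
by apply/measurable_EFinP; exact: measurable_funM.
Qed.
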